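(* For any fixed integer $k\geq 1$, every $K_t$-minor-free graph $G$ with girth at least $4k+1$ is properly $O\big((t\sqrt{\log t})^{2/(2k+1)}\big)$-colourable; that is, for each integer $k\geq 1$ there is a constant $C_k$ such that for every integer $t\geq 2$, every $K_t$-minor-free graph $G$ with girth at least $4k+1$ satisfies $\chi(G)\leq C_k\,(t\sqrt{\log t})^{2/(2k+1)}$.
   Context: Graphs are finite, simple and undirected; $\chi(G)$ is the usual (proper) chromatic number. A graph is $K_t$-minor-free if the complete graph $K_t$ is not a minor of it. The girth of a graph is the length of its shortest cycle (infinite for a forest). *)

(* Defs.v *)
From mathcomp Require Import all_boot.
Set Implicit Arguments.
Unset Strict Implicit.
Unset Printing Implicit Defensive.

Record sgraph := SGraph {
  vertex :> finType;
  adj : rel vertex;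
  adj_sym : symmetric adj;
  adj_irrefl : irreflexive adj }.

Lemma complete_sym n : symmetric (fun i j : 'I_n => i != j).
Proof. by move=> i j; rewrite eq_sym. Qed.

Lemma complete_irrefl n : irreflexive (fun i j : 'I_n => i != j).
Proof. by move=> i; rewrite eqxx. Qed.

Definition complete_graph (n : nat) : sgraph :=
  SGraph (@complete_sym n) (@complete_irrefl n).

Definition connected_in (G : sgraph) (A : {set G}) : bool :=
  [forall x in A, forall y in A,
     connect [rel u v : G | [&& u \in A, v \in A & adj u v]] x y].

(* H is a minor of G: there are nonempty connected pairwise disjoint branch
   sets of G indexed by the vertices of H, with an edge of G between the branch
   sets of any two adjacent vertices of H.  Contracting the branch sets and
   deleting what remains yields H. *)
Definition minor (H G : sgraph) : Prop :=
  exists B : H -> {set G},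
    [/\ forall x, B x != set0,
        forall x, connected_in (B x),
        forall x y, x != y -> [disjoint B x & B y]
      & forall x y, adj x y -> exists u v, [/\ u \in B x, v \in B y & adj u v]].

Definition minor_free (H G : sgraph) : Prop := ~ minor H G.

Definition proper_colouring (G : sgraph) (n : nat) (f : {ffun G -> 'I_n}) :=
  [forall x, forall y, adj x y ==> (f x != f y)].

Definition colourable (G : sgraph) (n : nat) : bool :=
  [exists f : {ffun G -> 'I_n}, proper_colouring f].

Lemma colourable_card (G : sgraph) : exists n, colourable G n.
Proof.
exists #|G|; apply/existsP; exists [ffun x => enum_rank x].
apply/forallP=> x; apply/forallP=> y; apply/implyP=> xy.
rewrite !ffunE (inj_eq enum_rank_inj); apply/eqP=> eq_xy.
by rewrite eq_xy adj_irrefl in xy.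
Qed.

Definition chromatic_number (G : sgraph) : nat := ex_minn (colourable_card G).

(* The length bound excludes the degenerate closed walk x, y, x, which ucycle
   accepts because it is a duplicate-free cyclic sequence. *)
Definition graph_cycle (G : sgraph) (c : seq G) : bool :=
  (2 < size c) && ucycleb (@adj G) c.

Definition has_cycle_length (G : sgraph) (n : nat) : bool :=
  [exists c : n.-tuple G, graph_cycle c].

(* None is the infinite girth of a forest.  Lengths up to #|G| suffice, a cycle
   having no repeated vertex. *)
Definition girth (G : sgraph) : option nat :=
  ohead [seq n <- iota 0 #|G|.+1 | has_cycle_length G n].

Definition girth_at_least (G : sgraph) (g : nat) : bool :=
  if girth G is Some n then g <= n else true.

Lemma girth_at_leastP (G : sgraph) (g : nat) :
  reflect (forall c : seq G, graph_cycle c -> g <= size c) (girth_at_least G g).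
Proof.
have bound (c : seq G) : graph_cycle c ->
    size c \in [seq n <- iota 0 #|G|.+1 | has_cycle_length G n].
  move=> cyc_c; rewrite mem_filter mem_iota add0n ltnS; apply/andP; split.
    by apply/existsP; exists (in_tuple c).
  by case/and3P: cyc_c => _ _ /card_uniqP <-; rewrite max_card.
have sorted_s : sorted leq [seq n <- iota 0 #|G|.+1 | has_cycle_length G n].
  by apply: sorted_filter (iota_sorted _ _); apply: leq_trans.
rewrite /girth_at_least /girth.
case def_s: [seq n <- _ | _] bound sorted_s => [|m s] bound sorted_s /=.
  by apply: ReflectT => c /bound.
apply: (iffP idP) => [le_gm c /bound | ge_g].
  rewrite inE => /predU1P[-> // | s_c]; apply: leq_trans le_gm _.
  by have /allP/(_ _ s_c) := order_path_min leq_trans sorted_s.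
have: m \in [seq n <- iota 0 #|G|.+1 | has_cycle_length G n].
  by rewrite def_s mem_head.
by rewrite mem_filter => /andP[/existsP[c /ge_g]]; rewrite size_tuple.
Qed.

(* Main.v *)
(* A K_t-minor-free graph of girth at least 4k+1 is shown to be degenerate.
   Kostochka--Thomason (by the argument of Alon, Krivelevich and Sudakov): a
   graph of average degree at least C t sqrt(log t) has a K_t minor.  By
   Mader's contraction argument one may assume minimum degree at least half the
   order and that any two vertices are joined, robustly, by very short paths;
   random sets of about sqrt(log t) vertices are then pairwise adjacent, and
   each of them is made connected by a few extra vertices.
   Kuehn--Osthus: a graph of minimum degree d ~ s^2 and girth at least 4k+1 has
   a minor of average degree of order s^(2k+1).  Choose hubs at random with
   density about s^(1-2k), so that a vertex sees about s hubs at distance k, and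
   let each vertex join the cell of a random one of them.  An edge uv joins the
   cells of hubs x and y; because of the girth the paths of length 2k+1 from x
   to y are internally disjoint, so there are at most about s^2 of them, each
   surviving with probability s^-2, and a typical pair of cells is joined by a
   bounded number of edges. *)
Require Import Defs.
From mathcomp Require Import all_boot.
From mathcomp Require Import zify.
Set Implicit Arguments.
Unset Strict Implicit.
Unset Printing Implicit Defensive.

(** * Minors of graphs on a fixed vertex type *)

(** The exponent comes from balancing the two minors. Minimum degree of order s^2 forces a minor of
    average degree of order s^(2k+1), which without a K_t minor stays below D, of order t sqrt(log
    t). So s can be taken of order (t sqrt(log t))^(1/(2k+1)), and a greedy colouring uses O(s^2)
    colours. The obstacle is irregularity: the maximum degree can only be brought down to the order
    of D, far above s^2. Hence walks follow out-neighbour lists of one fixed size, and random labels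
    neutralise large in-degrees, which would otherwise spoil both the number of hubs and the number
    of walks ending at a hub. Probabilities appear as cardinalities of sets of label functions, with
    denominators cleared; an expectation is a sum over all labellings. That few edges join the same
    two cells is a second moment bound on pairs of arcs. In the lemmas the k of the theorem is
    [k.+1]. *)

Definition nbr (T : finType) (e : rel T) (W : {set T}) (x : T) : {set T} :=
  [set y in W | e x y].

(* Ordered pairs: every edge counts twice. *)
Definition arcs (T : finType) (e : rel T) (W : {set T}) : nat :=
  \sum_(x in W) #|nbr e W x|.

Definition in_rel (T : finType) (e : rel T) (A : {set T}) : rel T :=
  [rel u v | [&& u \in A, v \in A & e u v]].

Definition conn (T : finType) (e : rel T) (A : {set T}) : bool :=
  [forall x in A, forall y in A, connect (in_rel e A) x y].

(* (W, e) is a minor of (WS, f).  Graphs live on subsets of a fixed type, so that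
   deleting and contracting vertices does not change the type. *)
Definition gmodel (S T : finType) (WS : {set S}) (f : rel S)
    (W : {set T}) (e : rel T) : Prop :=
  exists B : T -> {set S},
    [/\ forall x, x \in W -> B x \subset WS /\ B x != set0,
        forall x, x \in W -> conn f (B x),
        forall x y, x \in W -> y \in W -> x != y -> [disjoint B x & B y]
      & forall x y, x \in W -> y \in W -> e x y ->
          exists u v, [/\ u \in B x, v \in B y & f u v]].

Lemma connP (T : finType) (e : rel T) (A : {set T}) :
  reflect {in A &, forall x y, connect (in_rel e A) x y} (conn e A).
Proof.
apply: (iffP forall_inP) => [h x y xA yA|h x xA].
  exact: (forall_inP (h x xA)).
by apply/forall_inP => y yA; apply: h.
Qed.

Lemma in_rel_sub (T : finType) (e : rel T) (A B : {set T}) :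
  A \subset B -> subrel (connect (in_rel e A)) (connect (in_rel e B)).
Proof.
move=> sAB; apply: connect_sub => x y /and3P[xA yA exy]; apply: connect1.
by rewrite /in_rel /= (subsetP sAB _ xA) (subsetP sAB _ yA).
Qed.

Lemma in_rel_sym (T : finType) (e : rel T) (A : {set T}) :
  symmetric e -> connect_sym (in_rel e A).
Proof.
move=> se; apply: sym_connect_sym => x y; rewrite /in_rel /= se.
by case: (x \in A); case: (y \in A).
Qed.

Lemma conn_root (T : finType) (e : rel T) (A : {set T}) (r : T) :
  symmetric e -> (forall x, x \in A -> connect (in_rel e A) x r) -> conn e A.
Proof.
move=> se h; apply/connP => x y xA yA.
by apply: connect_trans (h x xA) _; rewrite in_rel_sym // h.
Qed.

Lemma conn1 (T : finType) (e : rel T) (x : T) : conn e [set x].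
Proof. by apply/connP => u v /set1P-> /set1P->; apply: connect0. Qed.

Lemma conn2 (T : finType) (e : rel T) (x y : T) :
  symmetric e -> e x y -> conn e [set x; y].
Proof.
move=> se exy; apply: (conn_root (r := x)) => // u /set2P[]->; first exact: connect0.
by apply: connect1; rewrite /in_rel /= !inE !eqxx orbT se.
Qed.

Lemma conn_bigcup (S I : finType) (f : rel S) (P : pred I) (F : I -> {set S}) (r : S) :
  symmetric f -> (forall i, P i -> conn f (F i)) -> (forall i, P i -> r \in F i) ->
  conn f (\bigcup_(i | P i) F i).
Proof.
move=> sf cF rF; apply: (conn_root (r := r)) => // x /bigcupP[i Pi xi].
apply: (in_rel_sub (A := F i)); first exact: bigcup_sup.
by apply: (connP _ _ (cF i Pi)) => //; apply: rF.
Qed.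

(** Branch sets compose: a path inside [C x] lifts edge by edge to the union of the sets [B y], each
    of which is connected. *)
Lemma gmodel_trans (S T U : finType) (WS : {set S}) (f : rel S) (W : {set T})
    (e : rel T) (W' : {set U}) (e' : rel U) :
  symmetric f -> gmodel WS f W e -> gmodel W e W' e' -> gmodel WS f W' e'.
Proof.
move=> sf [B [BW Bc Bd Be]] [C [CW Cc Cd Ce]].
have CWin x y : x \in W' -> y \in C x -> y \in W.
  by move=> xW; apply/subsetP; case: (CW x xW).
exists (fun x => \bigcup_(y in C x) B y); split.
- move=> x xW; have [sCW /set0Pn[y yC]] := CW x xW; split.
    by apply/bigcupsP => z zC; case: (BW z (subsetP sCW _ zC)).
  have [_ /set0Pn[u uB]] := BW y (CWin x y xW yC).
  by apply/set0Pn; exists u; apply/bigcupP; exists y.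
- move=> x xW; set A := \bigcup_(y in C x) B y.
  have BA y : y \in C x -> B y \subset A by move=> yC; apply: bigcup_sup.
  have inB y u v : y \in C x -> u \in B y -> v \in B y -> connect (in_rel f A) u v.
    move=> yC uB vB; apply: (in_rel_sub (BA y yC)).
    by apply: (connP _ _ (Bc y (CWin x y xW yC))).
  apply/connP => u v /bigcupP[y yC uy] /bigcupP[y' yC' vy'].
  have /connectP[p] := connP _ _ (Cc x xW) y y' yC yC'.
  elim: p y u yC uy => [|z p IHp] y u yC uy /=.
    by move=> _ eq_y; apply: (inB y) => //; rewrite -eq_y.
  case/andP=> /and3P[_ zC eyz] pp lp.
  have [a [b [ay bz fab]]] := Be y z (CWin _ _ xW yC) (CWin _ _ xW zC) eyz.
  apply: connect_trans (inB y u a yC uy ay) _.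
  apply: connect_trans (IHp z b zC bz pp lp); apply: connect1.
  by rewrite /in_rel /= fab (subsetP (BA y yC)) // (subsetP (BA z zC)).
- move=> x y xW yW xy; rewrite disjoint_subset; apply/subsetP => u /bigcupP[a aC uB].
  rewrite inE; apply/bigcupP => -[b bC vB].
  have nab : a != b.
    by apply/eqP => eab; move: (Cd x y xW yW xy); rewrite disjoint_subset => /subsetP/(_ a aC); rewrite inE eab bC.
  by have := Bd a b (CWin _ _ xW aC) (CWin _ _ yW bC) nab; rewrite disjoint_subset => /subsetP/(_ u uB); rewrite inE vB.
- move=> x y xW yW /(Ce x y xW yW)[a [b [aC bC eab]]].
  have [u [v [uB vB fuv]]] := Be a b (CWin _ _ xW aC) (CWin _ _ yW bC) eab.
  by exists u, v; split=> //; apply/bigcupP; [exists a | exists b].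
Qed.

Lemma gmodel_sub (T : finType) (W W' : {set T}) (e e' : rel T) :
  W' \subset W -> (forall x y, x \in W' -> y \in W' -> e' x y -> e x y) ->
  gmodel W e W' e'.
Proof.
move=> sW se; exists (fun x => [set x]); split.
- move=> x xW; rewrite sub1set (subsetP sW) //; split=> //.
  by apply/set0Pn; exists x; rewrite inE.
- by move=> x _; apply: conn1.
- by move=> x y _ _ xy; rewrite disjoints1 inE.
by move=> x y xW yW exy; exists x, y; rewrite !inE !eqxx; split=> //; apply: se.
Qed.

Lemma gmodel_minor (G : sgraph) (t : nat) :
  gmodel [set: G] (@adj G) [set: 'I_t] (fun i j => i != j) ->
  minor (complete_graph t) G.
Proof.
move=> [B [BW Bc Bd Be]]; exists B; split.
- by move=> x; case: (BW x (in_setT x)).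
- by move=> x; have := Bc x (in_setT x).
- by move=> x y xy; apply: Bd.
by move=> x y xy; apply: Be.
Qed.

Lemma nbrP (T : finType) (e : rel T) W x y : (y \in nbr e W x) = (y \in W) && e x y.
Proof. by rewrite inE. Qed.

Lemma nbr_setD1 (T : finType) (e : rel T) (W : {set T}) x v :
  nbr e (W :\ v) x = nbr e W x :\ v.
Proof. by apply/setP => y; rewrite !inE andbA. Qed.

Lemma sum_nbr_card (T : finType) (e : rel T) (A B : {set T}) :
  symmetric e -> \sum_(x in A) #|nbr e B x| = \sum_(y in B) #|nbr e A y|.
Proof.
move=> se.
have h (C : {set T}) x : #|nbr e C x| = \sum_(y in C) e x y.
  by rewrite -sum1_card big_mkcond [RHS]big_mkcond /=; apply: eq_bigr => y _; rewrite inE; case: (y \in C); case: (e x y).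
under eq_bigr do rewrite h.
rewrite exchange_big /=; apply: eq_bigr => y _; rewrite h; apply: eq_bigr => x _.
by rewrite se.
Qed.

Lemma arcs_setD1 (T : finType) (e : rel T) (W : {set T}) (v : T) :
  symmetric e -> irreflexive e -> v \in W ->
  arcs e W = arcs e (W :\ v) + 2 * #|nbr e W v|.
Proof.
move=> se ie vW; rewrite /arcs (big_setD1 v vW) /=.
have -> : \sum_(x in W :\ v) #|nbr e W x| =
          \sum_(x in W :\ v) #|nbr e (W :\ v) x| + \sum_(x in W :\ v) (e v x : nat).
  rewrite -big_split; apply: eq_bigr => x xW /=.
  by rewrite nbr_setD1 (cardsD1 v (nbr e W x)) nbrP vW se addnC.
have -> : \sum_(x in W :\ v) (e v x : nat) = #|nbr e W v|.
  rewrite -sum1_card big_mkcond [RHS]big_mkcond; apply: eq_bigr => x _.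
  rewrite !inE; case: eqP => [->|_] /=; first by rewrite ie andbF.
  by case: (x \in W); case: (e v x).
lia.
Qed.

Lemma arcs_card1 (T : finType) (e : rel T) (W : {set T}) :
  irreflexive e -> #|W| <= 1 -> arcs e W = 0.
Proof.
move=> ie W1; apply: big1 => x xW; apply/eqP; rewrite cards_eq0; apply/eqP/setP => y.
rewrite !inE; apply/negP => /andP[yW exy].
by move: exy; rewrite (card_le1_eqP W1 x y xW yW) ie.
Qed.

Lemma pairs_arcs (T : finType) (e : rel T) (W : {set T}) :
  #|[set p : T * T | [&& p.1 \in W, p.2 \in W & e p.1 p.2]]| = arcs e W.
Proof.
rewrite /arcs; under eq_bigr do rewrite -sum1_card.
rewrite pair_big_dep /= -sum1_card; apply: eq_bigl => -[x y] /=.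
by rewrite !inE.
Qed.

Lemma card_bigcup_leq (I T : finType) (P : pred I) (F : I -> {set T}) :
  #|\bigcup_(i | P i) F i| <= \sum_(i | P i) #|F i|.
Proof.
apply: (big_ind2 (fun (A : {set _}) m => #|A| <= m)) => //; first by rewrite cards0.
by move=> A m C p hA hC; apply: leq_trans (leq_card_setU _ _) (leq_add hA hC).
Qed.

(** * Mader's contraction argument *)

Definition codeg (T : finType) (e : rel T) (W : {set T}) (x y : T) : nat :=
  #|nbr e W x :&: nbr e W y|.

Definition contract (T : finType) (e : rel T) (a b : T) : rel T :=
  fun x y => (x != y) && [|| e x y, (x == a) && e b y | (y == a) && e x b].

Lemma contract_sym (T : finType) (e : rel T) a b : symmetric e -> symmetric (contract e a b).
Proof.
move=> se x y; rewrite /contract eq_sym (se x y) (se b y) (se x b).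
by congr (_ && (_ || _)); rewrite orbC.
Qed.

Lemma contract_irr (T : finType) (e : rel T) a b : irreflexive (contract e a b).
Proof. by move=> x; rewrite /contract eqxx. Qed.

Lemma contract_gmodel (T : finType) (e : rel T) (W : {set T}) a b :
  symmetric e -> a \in W -> b \in W -> e a b ->
  gmodel W e (W :\ b) (contract e a b).
Proof.
move=> se aW bW eab; exists (fun x => if x == a then [set a; b] else [set x]); split.
- move=> x /setD1P[xb xW]; case: eqP => _; split.
  + by apply/subsetP => y /set2P[]->.
  + by apply/set0Pn; exists a; rewrite !inE eqxx.
  + by rewrite sub1set.
  by apply/set0Pn; exists x; rewrite !inE eqxx.
- by move=> x _; case: eqP => _; [apply: conn2 | apply: conn1].
- move=> x y /setD1P[xb _] /setD1P[yb _] xy.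
  case: (x =P a) => [xa|xa]; case: (y =P a) => [ya|ya].
  + by rewrite xa ya eqxx in xy.
  + by rewrite disjoint_sym disjoints1 !inE negb_or yb andbT; apply/eqP.
  + by rewrite disjoints1 !inE negb_or xb andbT; apply/eqP.
  by rewrite disjoints1 inE.
- move=> x y /setD1P[xb _] /setD1P[yb _] /andP[xy /or3P[exy|/andP[/eqP-> eby]|/andP[/eqP-> exb]]].
  + exists x, y; split=> //; by case: eqP => [->|_]; rewrite !inE eqxx.
  + exists b, y; rewrite eqxx !inE eqxx orbT; split=> //.
    by case: eqP => [->|_]; rewrite !inE eqxx.
  exists x, b; rewrite eqxx !inE eqxx orbT; split=> //.
  by case: eqP => [->|_]; rewrite !inE eqxx.
Qed.

(** The edge ab itself costs two arcs, and at each common neighbour two edges merge into one,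
    costing two more. *)
Lemma contract_arcs (T : finType) (e : rel T) (W : {set T}) a b :
  symmetric e -> irreflexive e -> a \in W -> b \in W -> e a b ->
  arcs e W <= arcs (contract e a b) (W :\ b) + 2 * codeg e W a b + 2.
Proof.
move=> se ie aW bW eab.
have nab : a != b by apply: contraTneq eab => ->; rewrite ie.
have aWb : a \in W :\ b by rewrite !inE nab.
rewrite /arcs (big_setD1 b bW) /= !(big_setD1 a aWb) /=.
have ha : #|nbr e W a| + #|nbr e W b| <=
    #|nbr (contract e a b) (W :\ b) a| + codeg e W a b + 2.
  rewrite -cardsUI /codeg addnAC leq_add2r.
  have -> : 2 = #|[set a; b]| by rewrite cards2 nab.
  apply: leq_trans (leq_card_setU _ _); apply: subset_leq_card.
  apply/subsetP => y; rewrite !inE /contract (eq_sym a y).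
  case: (y =P a) => [->|_]; first by rewrite !orbT.
  case: (y =P b) => [->|_]; first by rewrite !orbT.
  by rewrite !eqxx /= !orbF; case: (y \in W).
have hs : \sum_(x in W :\ b :\ a) #|nbr e W x| <=
    \sum_(x in W :\ b :\ a) #|nbr (contract e a b) (W :\ b) x| + codeg e W a b.
  have -> : codeg e W a b = \sum_(x in W :\ b :\ a) (e x a && e x b : nat).
    rewrite /codeg -sum1_card big_mkcond [RHS]big_mkcond; apply: eq_bigr => x _.
    rewrite !inE (se a) (se b); case: eqP => [->|_] /=; first by rewrite ie !andbF.
    case: eqP => [->|_] /=; first by rewrite ie !andbF.
    by case: (x \in W); case: (e x a); case: (e x b).
  rewrite -big_split /=; apply: leq_sum => x; rewrite !inE => /and3P[xa xb xW].
  rewrite (cardsD1 b (nbr e W x)) nbrP bW /=.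
  have sub : nbr e W x :\ b \subset nbr (contract e a b) (W :\ b) x.
    apply/subsetP => y; rewrite !inE /contract => /and3P[-> -> exy].
    by rewrite exy /= andbT; apply: contraTneq exy => ->; rewrite ie.
  case exb: (e x b); last by rewrite add0n (leq_trans (subset_leq_card sub)) ?leq_addr.
  case exa: (e x a) => /=; first by rewrite addnC leq_add2r subset_leq_card.
  rewrite addn0; have -> : true + #|nbr e W x :\ b| = #|a |: (nbr e W x :\ b)|.
    by rewrite cardsU1 !inE exa !andbF.
  apply: subset_leq_card; rewrite subUset sub andbT sub1set !inE nab aW /contract xa.
  by rewrite eqxx exb !orbT.
move: ha hs; rewrite /arcs; lia.
Qed.

Definition del_edge (T : finType) (e : rel T) (a b : T) : rel T :=
  fun x y => e x y && ([set x; y] != [set a; b]).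

Lemma del_edge_sym (T : finType) (e : rel T) a b : symmetric e -> symmetric (del_edge e a b).
Proof. by move=> se x y; rewrite /del_edge se setUC. Qed.

Lemma set2_eqP (T : finType) (x y a b : T) :
  [set x; y] = [set a; b] -> (x = a /\ y = b) \/ (x = b /\ y = a).
Proof.
move=> E.
have : x \in [set a; b] by rewrite -E !inE eqxx.
have : y \in [set a; b] by rewrite -E !inE eqxx orbT.
have : a \in [set x; y] by rewrite E !inE eqxx.
have : b \in [set x; y] by rewrite E !inE eqxx orbT.
move=> /set2P h1 /set2P h2 /set2P h3 /set2P h4.
by case: h1; case: h2; case: h3; case: h4 => *; subst; auto.
Qed.

Lemma del_edge_arcs (T : finType) (e : rel T) (W : {set T}) a b :
  symmetric e -> a \in W -> b \in W -> e a b -> a != b ->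
  arcs e W = arcs (del_edge e a b) W + 2.
Proof.
move=> se aW bW eab nab; rewrite /arcs.
have bWa : b \in W :\ a by rewrite !inE eq_sym nab.
rewrite !(big_setD1 a aW) /= !(big_setD1 b bWa) /=.
have hx u v : u \in W -> v \in W -> e u v -> u != v -> [set u; v] = [set a; b] ->
    #|nbr e W u| = #|nbr (del_edge e a b) W u| + 1.
  move=> uW vW euv nuv E; rewrite (cardsD1 v (nbr e W u)) nbrP vW euv /= addnC.
  congr (_ + _); apply: eq_card => y; rewrite !inE /del_edge.
  case: eqP => [->|nyv] /=; first by rewrite E eqxx /= !andbF.
  have -> : [set u; y] != [set a; b].
    by apply/eqP; rewrite -E => /set2_eqP[[_ /nyv]|[/eqP]] //; rewrite (negPf nuv).
  by rewrite andbT.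
rewrite (hx a b) // (hx b a) //; last first.
- by rewrite setUC.
- by rewrite eq_sym.
- by rewrite se.
have -> : \sum_(x in W :\ a :\ b) #|nbr (del_edge e a b) W x| =
          \sum_(x in W :\ a :\ b) #|nbr e W x|.
  apply: eq_bigr => x; rewrite !inE => /and3P[xb xa xW]; apply: eq_card => y.
  rewrite !inE /del_edge.
  have -> : [set x; y] != [set a; b]; last by rewrite andbT.
  by apply/eqP => /set2_eqP[[E _]|[E _]]; [move: xa | move: xb]; rewrite E eqxx.
lia.
Qed.

(** Three reductions keep the average degree at least [2 * D]: deleting a vertex of degree at most
    D, contracting an edge with fewer than D common neighbours, and deleting an edge when two arcs
    are to spare. When none applies, some vertex has degree at most [2 * D], and its neighbourhood
    is the required graph: codegrees in W become degrees there. *)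
Lemma mader (T : finType) (W : {set T}) (e : rel T) (D : nat) :
  0 < D -> symmetric e -> irreflexive e -> W != set0 -> 2 * D * #|W| <= arcs e W ->
  exists (W' : {set T}) (e' : rel T), [/\ symmetric e', irreflexive e', gmodel W e W' e', W' != set0 &
    #|W'| <= 2 * D /\ forall x, x \in W' -> D <= #|nbr e' W' x| ].
Proof.
move=> D0 se ie W0.
have [n] := ubnP #|W|; have [m] := ubnP (arcs e W).
elim: n m W e se ie W0 => // n IHn m; elim: m => // m IHm W e se ie W0 lem len hD.
have W1 : 1 < #|W|.
  rewrite ltnNge; apply/negP => W1; move: hD; rewrite arcs_card1 //.
  by rewrite leqNgt !muln_gt0 D0 card_gt0 W0.
have pull (W1' : {set T}) (e1 : rel T) : symmetric e1 -> gmodel W e W1' e1 ->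
    (exists (W' : {set T}) (e' : rel T), [/\ symmetric e', irreflexive e', gmodel W1' e1 W' e', W' != set0 &
    #|W'| <= 2 * D /\ forall x, x \in W' -> D <= #|nbr e' W' x| ]) ->
    (exists (W' : {set T}) (e' : rel T), [/\ symmetric e', irreflexive e', gmodel W e W' e', W' != set0 &
    #|W'| <= 2 * D /\ forall x, x \in W' -> D <= #|nbr e' W' x| ]).
  move=> se1 g1 [W' [e' [h1 h2 h3 h4 h5]]]; exists W', e'; split=> //.
  exact: gmodel_trans g1 h3.
have setD1n0 v : v \in W -> W :\ v != set0 /\ #|W :\ v| = #|W|.-1.
  by move=> vW; rewrite -card_gt0 (cardsD1 v W) vW in W1 *; split=> //; lia.
have [/exists_inP[v vW dv]|/exists_inPn hdeg] := boolP [exists v in W, #|nbr e W v| <= D].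
  have [Wv0 Wvc] := setD1n0 v vW.
  apply: (pull (W :\ v) e) => //; first by apply: gmodel_sub => //; apply: subD1set.
  apply: (IHn (arcs e (W :\ v)).+1) => //; first by lia.
  by move: hD; rewrite (arcs_setD1 se ie vW) Wvc; move: dv W1; nia.
have [/exists_inP[a aW /exists_inP[b bW /andP[eab hab]]]|/exists_inPn hcod] :=
    boolP [exists a in W, [exists b in W, e a b && (codeg e W a b < D)]].
  have [Wv0 Wvc] := setD1n0 b bW.
  apply: (pull (W :\ b) (contract e a b)); first exact: contract_sym.
    exact: contract_gmodel.
  apply: (IHn (arcs (contract e a b) (W :\ b)).+1) => //.
  - exact: contract_sym.
  - exact: contract_irr.
  - by lia.
  by have := contract_arcs se ie aW bW eab; move: hD hab W1; rewrite Wvc; nia.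
have {}hcod a b : a \in W -> b \in W -> e a b -> D <= codeg e W a b.
  move=> aW bW eab; have := hcod a aW => /exists_inPn/(_ b bW); rewrite eab /=.
  by rewrite -leqNgt.
have [big|small] := leqP (2 * D * #|W| + 2) (arcs e W).
  have [a aW] := set0Pn _ W0.
  have /card_gt0P[b] : 0 < #|nbr e W a| by have := hdeg a aW; lia.
  rewrite nbrP => /andP[bW eab].
  have nab : a != b by apply: contraTneq eab => ->; rewrite ie.
  have harc := del_edge_arcs se aW bW eab nab.
  apply: (pull W (del_edge e a b)); first exact: del_edge_sym.
    by apply: gmodel_sub => // x y _ _ /andP[].
  apply: IHm => //; try lia.
  - exact: del_edge_sym.
  - by move=> x; rewrite /del_edge ie.
have [/exists_inP[v vW dv]|/exists_inPn hall] := boolP [exists v in W, #|nbr e W v| <= 2 * D].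
  exists (nbr e W v), e; split=> //.
  - by apply: gmodel_sub => //; apply/subsetP => x; rewrite nbrP => /andP[].
  - by rewrite -card_gt0; have := hdeg v vW; lia.
  split=> // x; rewrite nbrP => /andP[xW evx]; apply: leq_trans (hcod v x vW xW evx) _.
    by apply: subset_leq_card; apply/subsetP => y; rewrite !inE => /andP[-> /andP[_ ->]].
(* If all degrees exceed [2 * D], the surplus of arcs is at least [#|W|], hence at least 2; but at
   most one spare arc is left. *)
have : (2 * D).+1 * #|W| <= arcs e W.
  rewrite mulnC -sum_nat_const; apply: leq_sum => x xW.
  by rewrite ltnNge hall.
move: small W1; nia.
Qed.

(** * Complete minors in dense graphs *)

Definition undom (T : finType) (e : rel T) (W B : {set T}) : {set T} :=
  [set v in W | [forall b in B, ~~ e v b]].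

Lemma undomS (T : finType) (e : rel T) (W A B : {set T}) :
  A \subset B -> undom e W B \subset undom e W A.
Proof.
move=> sAB; apply/subsetP => v; rewrite !inE => /andP[-> /forall_inP h].
by apply/forall_inP => a /(subsetP sAB); apply: h.
Qed.

(* Counting among the s-tuples of X: at most a quarter of them leave too many
   vertices of W undominated, and at most half of them lie inside some U j. *)
Lemma good_tuple (T : finType) (e : rel T) (W X : {set T}) (s t : nat) (U : nat -> {set T}) :
  0 < s -> X \subset W -> #|W| <= 2 * #|X| -> 0 < #|X| ->
  (forall v, v \in W -> #|W| <= 4 * #|nbr e X v|) ->
  (forall j, j < t -> #|U j| * 4 ^ s <= 4 * 3 ^ s * #|W|) ->
  2 * t * 8 ^ s * 3 ^ (s ^ 2) <= 4 ^ (s ^ 2) ->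
  exists f : {ffun 'I_s -> T},
    [/\ forall i, f i \in X, forall j, j < t -> exists i, f i \notin U j
      & #|undom e W [set f i | i in 'I_s]| * 4 ^ s <= 4 * 3 ^ s * #|W| ].
Proof.
move=> s0 sXW hW X0 hdeg hU hst; set n := #|W|.
pose F := [set f : {ffun 'I_s -> T} | f \in ffun_on X].
pose im (f : {ffun 'I_s -> T}) := [set f i | i in 'I_s].
pose B1 (j : 'I_t) := [set f : {ffun 'I_s -> T} | f \in ffun_on (U j)].
pose B2 := [set f in F | 4 * 3 ^ s * n < #|undom e W (im f)| * 4 ^ s].
have cF : #|F| = #|X| ^ s by rewrite cardsE card_ffun_on card_ord.
have [/exists_inP[f fF]|/exists_inPn hbad] :=
    boolP [exists f in F, (f \notin B2) && [forall j, f \notin B1 j]].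
  case/andP => fB2 /forallP fB1; exists f; split.
  - by move: fF; rewrite inE => /ffun_onP.
  - move=> j jt; have := fB1 (Ordinal jt); rewrite inE => h.
    apply/existsP; move: h; apply: contraR; rewrite negb_exists => /forallP h.
    by apply/ffun_onP => i; have := h i; rewrite negbK.
  by move: fB2; rewrite inE fF /= -leqNgt.
exfalso.
have sub : F \subset (\bigcup_j B1 j) :|: B2.
  apply/subsetP => f fF; have := hbad f fF; rewrite negb_and negbK in_setU orbC.
  case/orP => [|->]; last by rewrite orbT.
  rewrite negb_forall => /existsP[j]; rewrite negbK => fj.
  by apply/orP; left; apply/bigcupP; exists j.
have h1 : #|F| <= \sum_(j < t) #|U j| ^ s + #|B2|.
  apply: leq_trans (subset_leq_card sub) _; apply: leq_trans (leq_card_setU _ _) _.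
  rewrite leq_add2r.
  have : #|\bigcup_j B1 j| <= \sum_(j < t) #|B1 j|.
    apply: (big_ind2 (fun (A : {set _}) m => #|A| <= m)) => //; first by rewrite cards0.
    by move=> A m C p hA hC; apply: leq_trans (leq_card_setU _ _) (leq_add hA hC).
  move/leq_trans; apply; apply: leq_sum => j _.
  by rewrite cardsE card_ffun_on card_ord.
have h2 : 4 * #|B2| <= #|X| ^ s.
  have n0 : 0 < n by apply: leq_trans X0 (subset_leq_card sXW).
  rewrite -(leq_pmul2r (m := 3 ^ s * n)) ?muln_gt0 ?expn_gt0 //.
  have -> : 4 * #|B2| * (3 ^ s * n) = #|B2| * (4 * 3 ^ s * n) by lia.
  (* Markov's inequality: all s coordinates miss the neighbourhood of v with probability at most
     (3/4)^s, and four times the mean is exceeded with probability at most 1/4. *)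
  have hs : \sum_(f in F) #|undom e W (im f)| = \sum_(v in W) #|X :\: nbr e X v| ^ s.
    under eq_bigr do rewrite -sum1_card.
    rewrite (exchange_big_dep (mem W)) /=; last by move=> f v _; rewrite inE => /andP[].
    apply: eq_bigr => v vW; rewrite sum1_card -[s in RHS]card_ord -card_ffun_on.
    apply: eq_card => f; rewrite unfold_in /= [f \in F]inE [v \in _]inE vW /=.
    apply/andP/ffun_onP => [[/ffun_onP fX /forall_inP fv] i|h].
      by rewrite !inE fX /= (fv (f i)) //; apply: imset_f.
    split; first by apply/ffun_onP => i; have := h i; rewrite inE => /andP[].
    apply/forall_inP => x /imsetP[i _ ->]; have := h i; rewrite !inE => /andP[+ xX].
    by rewrite xX.
  apply: leq_trans (_ : 4 ^ s * \sum_(f in F) #|undom e W (im f)| <= _).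
    rewrite big_distrr /= -sum_nat_const.
    apply: leq_trans (_ : \sum_(f in B2) 4 ^ s * #|undom e W (im f)| <= _).
      by apply: leq_sum => f; rewrite inE mulnC => /andP[_]; rewrite (mulnC (4 ^ s)); lia.
    rewrite [leqRHS]big_mkcond [leqLHS]big_mkcond /=; apply: leq_sum => f _.
    by rewrite [f \in B2]inE; case: (f \in F); rewrite /= ?if_same //; case: ifP.
  rewrite hs big_distrr /= [leqRHS]mulnCA [leqRHS]mulnA [leqRHS]mulnC.
  rewrite -[leqRHS]sum_nat_const.
  apply: leq_sum => v vW; rewrite -!expnMn leq_exp2r //.
  have hN : nbr e X v \subset X by apply/subsetP => y; rewrite inE => /andP[].
  by have := hdeg v vW; rewrite cardsD (setIidPr hN); have := subset_leq_card sXW; lia.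
(* The size of [U j] is at most 4 (3/4)^s [#|W|], so at most 8 (3/4)^s [#|X|]. The s-th power of
   this ratio is the source of 8^s 3^(s^2) in the hypothesis. *)
have h3 : 4 ^ (s ^ 2) * \sum_(j < t) #|U j| ^ s <= t * (8 ^ s * 3 ^ (s ^ 2) * #|X| ^ s).
  rewrite big_distrr /=.
  apply: leq_trans (_ : \sum_(j < t) 8 ^ s * 3 ^ (s ^ 2) * #|X| ^ s <= _); last first.
    by rewrite sum_nat_const card_ord.
  apply: leq_sum => j _.
  rewrite -!mulnn !expnM -!expnMn leq_exp2r //.
  have := hU j (ltn_ord j); rewrite mulnC -/n => h; apply: leq_trans h _.
  by have := leq_mul (leqnn (4 * 3 ^ s)) hW; rewrite -/n; lia.
have X0s : 0 < #|X| ^ s by rewrite expn_gt0 X0.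
have P0 : 0 < 4 ^ (s ^ 2) by rewrite expn_gt0.
rewrite cF in h1.
have h4 : 2 * (4 ^ (s ^ 2) * \sum_(j < t) #|U j| ^ s) <= 4 ^ (s ^ 2) * #|X| ^ s.
  apply: leq_trans (leq_mul (leqnn 2) h3) _; rewrite !mulnA leq_mul2r.
  by rewrite hst orbT.
move: h4; rewrite mulnCA leq_pmul2l //; lia.
Qed.

(** Short connections that survive the removal of any z vertices; 4 is the order of a path u, a, b,
    v. *)
Definition linked (T : finType) (e : rel T) (W : {set T}) (z : nat) : Prop :=
  forall (Z : {set T}) u v, #|Z| <= z -> u \in W :\: Z -> v \in W :\: Z ->
    exists A : {set T},
      [/\ A \subset W :\: Z, u \in A, v \in A, conn e A & #|A| <= 4].

(** The branch sets are built greedily. Each leaves at most 4 (3/4)^s [#|W|] vertices undominated,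
    so some s-tuple avoiding the earlier sets meets the neighbourhood of every one of them and again
    dominates well. Linking its s members to the first one gives a connected set of at most [4 * s]
    vertices; all sets together use at most [4 * s * t], the number of deletions that must be
    tolerated. *)
Lemma linked_clique (T : finType) (e : rel T) (W : {set T}) (s t : nat) :
  symmetric e -> 0 < s -> W != set0 -> linked e W (4 * s * t) ->
  (forall v, v \in W -> #|W| + 4 * (4 * s * t) <= 4 * #|nbr e W v|) ->
  2 * (4 * s * t) <= #|W| ->
  2 * t * 8 ^ s * 3 ^ (s ^ 2) <= 4 ^ (s ^ 2) ->
  gmodel W e [set: 'I_t] (fun i j => i != j).
Proof.
move=> se s0 W0 lW hdeg hW hst.
suff: forall i, i <= t -> exists B : nat -> {set T},
    (forall j, j < i -> [/\ B j \subset W, B j != set0, conn e (B j), #|B j| <= 4 * s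
       & #|undom e W (B j)| * 4 ^ s <= 4 * 3 ^ s * #|W|]) /\
    (forall j l, j < l < i -> [disjoint B j & B l] /\
       exists u v, [/\ u \in B j, v \in B l & e u v]).
  case/(_ t (leqnn t)) => B [h1 h2]; exists (fun i : 'I_t => B i); split.
  - by move=> i _; case: (h1 i (ltn_ord i)).
  - by move=> i _; case: (h1 i (ltn_ord i)).
  - move=> i j _ _; rewrite neq_ltn => /orP[ij|ji].
      by case: (h2 i j) => //; rewrite ij ltn_ord.
    by rewrite disjoint_sym; case: (h2 j i) => //; rewrite ji ltn_ord.
  - move=> i j _ _; rewrite neq_ltn => /orP[ij|ji].
      by case: (h2 i j) => //; rewrite ij ltn_ord.
    case: (h2 j i); first by rewrite ji ltn_ord.
    by move=> _ [u [v [uB vB euv]]]; exists v, u; rewrite se.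
elim=> [|i IHi] it; first by exists (fun=> set0); split=> // j l; rewrite ltn0 andbF.
have [B [h1 h2]] := IHi (ltnW it).
pose Z := \bigcup_(j < i) B j.
have cZ : #|Z| <= 4 * s * t.
  apply: leq_trans (card_bigcup_leq _ _) _.
  apply: leq_trans (_ : \sum_(j < i) 4 * s <= _).
    by apply: leq_sum => j _; case: (h1 j (ltn_ord j)).
  by rewrite sum_nat_const card_ord mulnC leq_mul2l (ltnW it) orbT.
have cX : #|W| <= #|W :\: Z| + 4 * s * t.
  rewrite cardsD; apply: leq_trans (_ : #|W| - #|W :&: Z| + #|W :&: Z| <= _).
    by rewrite subnK // subset_leq_card // subsetIl.
  by rewrite leq_add2l (leq_trans _ cZ) // subset_leq_card // subsetIr.
have cW0 : 0 < #|W| by rewrite card_gt0.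
(* Indices from i on receive the empty set, so that the size bound holds for every j < t. *)
have [||||f [fX fU fd]] := @good_tuple T e W (W :\: Z) s t
    (fun j => if j < i then undom e W (B j) else set0) s0 (subsetDl _ _) _ _ _ _ hst.
- lia.
- lia.
- move=> v vW; have := hdeg v vW.
  have : #|nbr e W v| <= #|nbr e (W :\: Z) v| + #|Z|.
    apply: leq_trans (leq_card_setU _ _); apply: subset_leq_card.
    by apply/subsetP => y; rewrite !inE => /andP[-> ->]; case: (y \in Z).
  by move: cZ; lia.
- by move=> j jt; case: ifP => [ji|_]; [case: (h1 j ji) | rewrite cards0].
pose r := f (Ordinal s0).
have /fin_all_exists[A hA] : forall i, exists A : {set T},
    [/\ A \subset W :\: Z, r \in A, f i \in A, conn e A & #|A| <= 4].
  by move=> l; exact: (lW Z r (f l) cZ (fX _) (fX l)).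
pose Bn := \bigcup_l A l.
have BnX : Bn \subset W :\: Z by apply/bigcupsP => l _; case: (hA l).
have fBn l : f l \in Bn by apply/bigcupP; exists l => //; case: (hA l).
exists (fun j => if j == i then Bn else B j); split.
  move=> j; rewrite ltnS leq_eqVlt; case: eqP => [-> _|_ /= ji]; last exact: h1.
  split.
  - by apply: subset_trans BnX (subsetDl _ _).
  - by apply/set0Pn; exists r; apply: fBn.
  - by apply: (conn_bigcup (r := r)) => // l _; case: (hA l).
  - apply: leq_trans (card_bigcup_leq _ _) _.
    apply: leq_trans (_ : \sum_(l < s) 4 <= _).
      by apply: leq_sum => l _; case: (hA l).
    by rewrite sum_nat_const card_ord mulnC.
  - apply: leq_trans fd; rewrite leq_mul2r subset_leq_card ?orbT //.
    by apply: undomS; apply/subsetP => y /imsetP[l _ ->].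
move=> j l /andP[jl]; rewrite ltnS leq_eqVlt => /orP[/eqP li|li]; last first.
  rewrite ltn_eqF ?(ltn_trans jl) // ltn_eqF //; apply: h2; rewrite jl //.
rewrite li eqxx in jl *; rewrite ltn_eqF //; split.
  rewrite disjoint_sym disjoint_subset; apply/subsetP => y /(subsetP BnX).
  rewrite !inE => /andP[/negP yZ _]; apply/negP => yB; apply: yZ.
  by apply/bigcupP; exists (Ordinal jl).
have [a] := fU j (ltn_trans jl it); rewrite jl !inE.
have := fX a; rewrite inE => /andP[_ ->] /=; rewrite negb_forall => /existsP[b].
rewrite negb_imply negbK => /andP[bB eb]; exists b, (f a).
by rewrite se.
Qed.

(* After Mader's lemma the minimum degree is at least half the order.  If two
   vertices can be separated by few vertices, their neighbourhoods almost
   partition the graph with no edge in between, so that one of them is nearly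
   complete. *)
Lemma dense_clique (T : finType) (W : {set T}) (e : rel T) (D s t : nat) :
  symmetric e -> irreflexive e -> W != set0 -> 2 * D * #|W| <= arcs e W ->
  0 < s -> 0 < t -> 28 * s * t <= D ->
  2 * t * 8 ^ s * 3 ^ (s ^ 2) <= 4 ^ (s ^ 2) ->
  gmodel W e [set: 'I_t] (fun i j => i != j).
Proof.
move=> se0 ie0 W00 hD s0 t0 hst hexp.
have st0 : 0 < s * t by rewrite muln_gt0 s0.
have D0 : 0 < D by lia.
have [W' [e' [se ie gm W0 [cW hdeg]]]] := mader D0 se0 ie0 W00 hD.
refine (gmodel_trans se0 gm _); move: hdeg cW W0 => {gm hD W00 se0 ie0 W e}.
move: W' e' se ie => W e se ie hdeg cW W0.
pose z := 4 * s * t.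
(* The factor 7 serves the separated case: P has at most D + z vertices and degrees at least D - 2z,
   so two vertices of P share at least D - 5z neighbours, which has to exceed z. *)
have hz : 7 * z <= D by rewrite /z; lia.
have DW : D <= #|W|.
  have [v vW] := set0Pn _ W0; apply: leq_trans (hdeg v vW) _.
  by apply: subset_leq_card; apply/subsetP => y; rewrite inE => /andP[].
pose N (Z : {set T}) u := u |: nbr e (W :\: Z) u.
have [/existsP[Z /existsP[u /existsP[v]]]|hlk] := boolP [exists Z : {set T},
    exists u, exists v, [&& #|Z| <= z, u \in W :\: Z, v \in W :\: Z &
      ~~ [exists a in N Z u, exists b in N Z v, (a == b) || e a b]]]; last first.
  apply: (linked_clique (s := s)) => //; rewrite -/z; [|by move=> v vW; have := hdeg v vW; lia|lia].
  move=> Z u v cZ uX vX; move: hlk; rewrite negb_exists => /forallP/(_ Z).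
  rewrite negb_exists => /forallP/(_ u); rewrite negb_exists => /forallP/(_ v).
  rewrite cZ uX vX /= negbK => /exists_inP[a aN /exists_inP[b bN eab]].
  pose A := [set u; a; b; v]; exists A.
  have cl x y : x \in A -> y \in A -> (x == y) || e x y -> connect (in_rel e A) x y.
    move=> xA yA /orP[/eqP->|exy]; first exact: connect0.
    by apply: connect1; rewrite /in_rel /= xA yA.
  have uA : u \in A by rewrite !inE eqxx.
  have aA : a \in A by rewrite !inE eqxx !orbT.
  have bA : b \in A by rewrite !inE eqxx !orbT.
  have vA : v \in A by rewrite !inE eqxx !orbT.
  have inN y w : w \in W :\: Z -> y \in N Z w -> y \in W :\: Z /\ (w == y) || e w y.
    move=> wX /setU1P[->|]; first by rewrite eqxx.
    by rewrite nbrP => /andP[-> ->]; rewrite orbT.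
  have [aX ua] := inN a u uX aN; have [bX vb] := inN b v vX bN.
  have cau : connect (in_rel e A) a u by rewrite in_rel_sym // cl.
  have cba : connect (in_rel e A) b u.
    by apply: connect_trans _ cau; rewrite in_rel_sym // cl.
  split=> //.
  - by apply/subsetP => y; rewrite !in_setU !in_set1 => /orP[/orP[/orP[]|]|] /eqP->.
  - apply: (conn_root (r := u)) => // y.
    rewrite !in_setU !in_set1 => /orP[/orP[/orP[]|]|] /eqP-> //.
    by apply: connect_trans cba; apply: cl.
  - rewrite /A; do 3! (rewrite setUC cardsU1; apply: leq_trans (leq_add (leq_b1 _) (leqnn _)) _).
    by rewrite cards1.
case/and4P => cZ uX vX; set P := N Z u; set Q := N Z v => hPQ.
have {}hPQ a b : a \in P -> b \in Q -> (a != b) && ~~ e a b.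
  move=> aP bQ; rewrite -negb_or; move: hPQ; apply: contra => h.
  by apply/exists_inP; exists a => //; apply/exists_inP; exists b.
have inW w y : w \in W :\: Z -> y \in N Z w -> y \in W.
  move=> wX /setU1P[->|]; first by move: wX; rewrite inE => /andP[].
  by rewrite nbrP inE => /andP[/andP[_]].
have sPW : P \subset W by apply/subsetP => y; apply: inW.
have sQW : Q \subset W by apply/subsetP => y; apply: inW.
have cN w : w \in W :\: Z -> D <= #|N Z w| + z.
  move=> wX; have wW : w \in W by move: wX; rewrite inE => /andP[].
  apply: leq_trans (hdeg w wW) _; apply: leq_trans (leq_add (leqnn _) cZ).
  apply: leq_trans (leq_card_setU _ _); apply: subset_leq_card.
  by apply/subsetP => y; rewrite !inE => /andP[-> ->]; case: (y \in Z); rewrite ?orbT.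
have dPQ : [disjoint P & Q].
  rewrite disjoint_subset; apply/subsetP => a aP; rewrite inE; apply/negP => aQ.
  by have := hPQ a a aP aQ; rewrite eqxx.
have cPQ : #|P| + #|Q| <= #|W|.
  have := leq_card_setU P Q => -[_]; rewrite dPQ => /eqP <-.
  by apply: subset_leq_card; rewrite subUset sPW.
have cP := cN u uX; have cQ := cN v vX; rewrite -/P -/Q in cP cQ.
(* No edge goes from P to Q, and at most [2 * z] vertices lie outside both, since each has at least
   D - z vertices and [#|W| <= 2 * D]. *)
have degP p : p \in P -> D <= #|nbr e P p| + 2 * z.
  move=> pP; apply: leq_trans (hdeg p (subsetP sPW _ pP)) _.
  apply: leq_trans (_ : #|nbr e P p| + #|W :\: (P :|: Q)| <= _).
    apply: leq_trans (leq_card_setU _ _); apply: subset_leq_card.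
    apply/subsetP => y; rewrite in_setU !nbrP in_setD in_setU negb_or.
    move=> /andP[yW py]; rewrite yW py !andbT.
    case yP: (y \in P) => //=; apply/negP => yQ.
    by have := hPQ p y pP yQ; rewrite py andbF.
  have sPQ : P :|: Q \subset W by rewrite subUset; apply/andP.
  rewrite leq_add2l cardsD (setIidPr sPQ).
  by have := leq_card_setU P Q => -[_]; rewrite dPQ => /eqP ->; lia.
have gP : gmodel W e P e by apply: gmodel_sub.
refine (gmodel_trans se gP _).
apply: (linked_clique (s := s)) => //.
- by apply/set0Pn; exists u; rewrite !inE eqxx.
- rewrite -/z => Z' a b cZ' /setDP[aP aZ] /setDP[bP bZ].
  have /card_gt0P[c] : 0 < #|(nbr e P a :&: nbr e P b) :\: Z'|.
    rewrite cardsD.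
    have := subset_leq_card (subsetIr (nbr e P a :&: nbr e P b) Z').
    have := cardsUI (nbr e P a) (nbr e P b).
    have : #|nbr e P a :|: nbr e P b| <= #|P|.
      by apply: subset_leq_card; apply/subsetP => y; rewrite !inE => /orP[] /andP[].
    have := degP a aP; have := degP b bP; have : 0 < z by rewrite /z; lia.
    by lia.
  rewrite in_setD in_setI !nbrP -!andbA => /and5P[cZ'' cP' eac _ ebc].
  exists [set a; c; b]; split; rewrite ?inE ?eqxx ?orbT //.
  + apply/subsetP => y; rewrite !in_setU !in_set1 -orbA => /or3P[] /eqP->;
      by rewrite in_setD ?aZ ?bZ ?cZ'' ?aP ?bP ?cP'.
  + apply: (conn_root (r := c)) => // y.
    rewrite !in_setU !in_set1 -orbA => /or3P[] /eqP-> //.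
      by apply: connect1; rewrite /in_rel /= !in_setU !in_set1 !eqxx eac !orbT.
    by apply: connect1; rewrite /in_rel /= !in_setU !in_set1 !eqxx ebc !orbT.
  + rewrite setUC cardsU1 cards2; case: (_ \notin _); case: (_ != _) => //.
- by move=> p pP; have := degP p pP; rewrite -/z; lia.
- by rewrite -/z; lia.
Qed.

(** * Girth and nonbacktracking walks *)

Definition girth_ge (T : eqType) (e : rel T) (g : nat) : Prop :=
  forall c : seq T, 2 < size c -> cycle e c -> uniq c -> g <= size c.

Fixpoint nonbacktracking (T : eqType) (s : seq T) : bool :=
  if s is x :: ((_ :: z :: _) as s') then (x != z) && nonbacktracking s' else true.

Lemma nonbacktracking_behead (T : eqType) (x : T) s :
  nonbacktracking (x :: s) -> nonbacktracking s.
Proof. by case: s => [|y [|z s]] //= /andP[]. Qed.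

(** Take the last entry x that recurs later. The stretch up to its recurrence is a cycle, of length
    at least 3 because e is irreflexive and x differs from the entry two places on. The recurrence
    itself makes the inequality strict. *)
Lemma nonbacktracking_cycle (T : eqType) (e : rel T) g (s : seq T) :
  irreflexive e -> girth_ge e g -> sorted e s -> nonbacktracking s -> ~~ uniq s ->
  g < size s.
Proof.
move=> ie hg; elim: s => // x p IHp hs hn.
have [up|nup] := boolP (uniq p); last first.
  move=> _; apply: ltn_trans (IHp _ _ nup) _ => //; first exact: path_sorted hs.
  exact: nonbacktracking_behead hn.
rewrite /= up andbT negbK => xp; rewrite ltnS.
have ip : index x p < size p by rewrite index_mem.
pose c := x :: take (index x p) p.
have sc : size c = (index x p).+1 by rewrite /= size_take ip.
apply: leq_trans (_ : size c <= _); last by rewrite sc.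
apply: hg.
- rewrite sc; case: p hs hn xp {IHp up c ip sc} => // y [|z p] /=.
    by rewrite inE andbT => exy _ /eqP E; rewrite E ie in exy.
  case/andP=> exy _ /andP[nxz _] _.
  case: (y =P x) => [E|_]; first by rewrite E ie in exy.
  by rewrite (eq_sym z) (negPf nxz).
- rewrite [cycle _ _]/= -[X in rcons _ X](nth_index x xp) -take_nth //.
  by move: hs; rewrite /= -{1}(cat_take_drop (index x p).+1 p) cat_path => /andP[].
- by rewrite /= take_uniq // andbT in_take_leq ?ltnn // ltnW.
Qed.

Lemma nonbacktracking_catrev (T : eqType) (p : seq T) a x r :
  nonbacktracking (x :: a :: p) -> nonbacktracking (a :: x :: r) ->
  nonbacktracking (catrev p (a :: x :: r)).
Proof.
elim: p a x r => //= c p IHp a x r /andP[xc h1] h2.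
by apply: (IHp c a (x :: r)) => //; rewrite [X in is_true X]/= eq_sym xc.
Qed.

Lemma sorted_catrev (T : eqType) (e : rel T) (p : seq T) a r :
  symmetric e -> path e a p -> path e a r -> sorted e (catrev p (a :: r)).
Proof.
move=> se; elim: p a r => //= c p IHp a r /andP[eac h1] h2.
by apply: (IHp c (a :: r)) => //=; rewrite se eac.
Qed.

(* After the common prefix, the reversal of one walk followed by the other is a
   nonbacktracking walk that repeats its end. *)
Lemma nonbacktracking_unique (T : eqType) (e : rel T) g (x : T) (p q : seq T) :
  symmetric e -> irreflexive e -> girth_ge e g ->
  path e x p -> path e x q -> nonbacktracking (x :: p) -> nonbacktracking (x :: q) ->
  last x p = last x q -> size p + size q < g -> p = q.
Proof.
move=> se ie hg.
have closed y r : path e y r -> nonbacktracking (y :: r) -> last y r = y -> size r < g -> r = [::].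
  case: r => // z r pr nr lr; rewrite ltnNge => /negP[]; rewrite -ltnS.
  apply: (@nonbacktracking_cycle _ e g (y :: z :: r)) => //.
  by rewrite cons_uniq -[X in X \in _]lr /= mem_last.
elim: p x q => [|a p IHp] x [|b q] //.
- by move=> _ pq _ nq /esym lq sq; rewrite (closed x (b :: q)).
- by move=> pp _ np _ lp; rewrite addn0 => sp; rewrite (closed x (a :: p)).
move=> pp pq np nq lpq spq; case: (eqVneq a b) => [E|nab].
  move: pq nq lpq; rewrite -E => pq nq lpq; congr (_ :: _).
  move: pp pq => /=/andP[_ pp] /andP[_ pq]; apply: (IHp a q) => //.
  - exact: nonbacktracking_behead np.
  - exact: nonbacktracking_behead nq.
  - by move: spq => /=; lia.
exfalso.
have : g < size (catrev p (a :: x :: b :: q)).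
  apply: (@nonbacktracking_cycle _ e) => //.
  - move: pp pq => /=/andP[exa pp] /andP[exb pq].
    by apply: sorted_catrev => //=; rewrite se exa exb.
  - by apply: nonbacktracking_catrev => //; rewrite [X in is_true X]/= nab.
  rewrite catrevE -cat_rcons -rev_cons cat_uniq; apply/negP => /and3P[_ /hasPn h _].
  have := h (last b q); rewrite [last b q \in _ :: _]in_cons mem_last orbT => /(_ isT).
  by rewrite mem_rev; move: lpq => /= <-; rewrite mem_last.
by rewrite catrevE size_cat size_rev; move: spq => /=; lia.
Qed.

Lemma girth_ge_sub (T : eqType) (e e' : rel T) g :
  subrel e' e -> girth_ge e g -> girth_ge e' g.
Proof. by move=> se hg c sc cc uc; apply: hg => //; apply: sub_cycle cc. Qed.

Lemma girth_ge_adj (G : sgraph) g : girth_at_least G g -> girth_ge (@adj G) g.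
Proof.
move=> /girth_at_leastP h c sc cc uc; apply: h; rewrite /graph_cycle sc /=.
by rewrite /ucycleb cc.
Qed.

Lemma common_nbr_unique (T : eqType) (e : rel T) (x y u v : T) :
  symmetric e -> irreflexive e -> girth_ge e 5 -> x != y ->
  e x u -> e u y -> e x v -> e v y -> u = v.
Proof.
move=> se ie hg xy xu uy xv vy.
suff [] : [:: u; y] = [:: v; y] by [].
by apply: (nonbacktracking_unique se ie hg (x := x)); rewrite /= ?xu ?uy ?xv ?vy ?xy.
Qed.

(** * Bounding the maximum degree *)

Definition pick_subset (T : finType) (r : nat) (A : {set T}) : {set T} :=
  [set y in take r (enum A)].

Lemma pick_subset_sub (T : finType) r (A : {set T}) : pick_subset r A \subset A.
Proof. by apply/subsetP => y; rewrite inE => /mem_take; rewrite mem_enum. Qed.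

Lemma card_pick_subset (T : finType) r (A : {set T}) :
  r <= #|A| -> #|pick_subset r A| = r.
Proof.
move=> rA; rewrite /pick_subset cardsE.
by rewrite (card_uniqP _) ?take_uniq ?enum_uniq // size_takel // -cardE.
Qed.

Lemma min_degree_subset (T : finType) (e : rel T) (W : {set T}) (d : nat) :
  symmetric e -> irreflexive e -> W != set0 -> 2 * d * #|W| <= arcs e W ->
  exists W' : {set T}, [/\ W' \subset W, W' != set0 &
    forall x, x \in W' -> d <= #|nbr e W' x| ].
Proof.
move=> se ie; have [n] := ubnP #|W|; elim: n W => // n IHn W Wn W0 hW.
have [/exists_inP[v vW dv]|/exists_inPn hd] := boolP [exists v in W, #|nbr e W v| < d].
  have cW : #|W| = #|W :\ v|.+1 by rewrite (cardsD1 v W) vW.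
  have [|||W' [sW W'0 hW']] := IHn (W :\ v).
  - by rewrite -ltnS -cW.
  - rewrite -card_gt0 lt0n; apply/negP => /eqP c0; move: hW dv.
    by rewrite arcs_card1 // ?cW ?c0 //; lia.
  - by move: hW dv; rewrite (arcs_setD1 se ie vW) cW; nia.
  by exists W'; split=> //; apply: subset_trans sW (subD1set _ _).
by exists W; split=> // x xW; rewrite leqNgt hd.
Qed.

Lemma gmodel_stars (T : finType) (e : rel T) (W Y U : {set T}) (f : T -> T) :
  symmetric e -> Y \subset W -> U \subset W :\: Y ->
  (forall u, u \in U -> e u (f u)) ->
  let B y := y |: [set u in U | f u == y] in
  gmodel W e Y (fun y z => (y != z) && [exists u in B y, exists v in B z, e u v]).
Proof.
move=> se sY sU hf B; exists B; split.
- move=> y yY; split; last by apply/set0Pn; exists y; apply: setU11.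
  apply/subsetP => x /setU1P[->|]; first exact: (subsetP sY).
  by rewrite inE => /andP[/(subsetP sU)]; rewrite inE => /andP[].
- move=> y yY; apply: (conn_root (r := y)) => // x /setU1P[->//|xB].
  have yB : y \in B y by apply: setU11.
  apply: connect1; rewrite /in_rel /= yB andTb; move: xB (xB); rewrite {1}inE => /andP[xU /eqP fx] xB.
  by rewrite setU1r //= -[X in e _ X]fx hf.
- move=> y z yY zY yz; rewrite disjoint_subset; apply/subsetP => x.
  rewrite !inE negb_or => /orP[/eqP->|/andP[xU /eqP fx]].
    rewrite yz /=; apply/negP => /andP[/(subsetP sU)].
    by rewrite inE yY.
  rewrite xU fx yz andbT; apply: contraTneq xU => ->.
  by apply/negP => /(subsetP sU); rewrite inE zY.
move=> y z _ _ /andP[_ /exists_inP[u uB /exists_inP[v vB euv]]].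
by exists u, v.
Qed.

(* First thin out to at most 8 d |W| arcs.  Contracting every other vertex into a
   neighbour in the set Y of vertices of large degree produces no parallel edges,
   as there is no 4-cycle; hence few edges meet Y, or the minor on Y is dense. *)
Lemma bounded_degree_subgraph (T : finType) (e : rel T) (W : {set T}) (d D : nat) :
  symmetric e -> irreflexive e -> girth_ge e 5 -> W != set0 -> 2 <= d ->
  (forall x, x \in W -> 4 * d <= #|nbr e W x|) ->
  (forall (W' : {set T}) (e' : rel T), symmetric e' -> irreflexive e' ->
     gmodel W e W' e' -> W' != set0 -> arcs e' W' < 2 * D * #|W'|) ->
  exists (e0 : rel T) (W' : {set T}),
    [/\ symmetric e0, subrel e0 e, W' \subset W, W' != set0 &
      forall x, x \in W' -> d <= #|nbr e0 W' x| <= 48 * D].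
Proof.
move=> se ie hg W0 d2 hdeg hD.
(* Every vertex selects [4 * d] neighbours and an edge survives if either end selected it, which
   leaves between [4 * d * #|W|] and [8 * d * #|W|] arcs. *)
pose L x := pick_subset (4 * d) (nbr e W x).
have LW x y : y \in L x -> (y \in W) && e x y.
  by move/(subsetP (pick_subset_sub _ _)); rewrite nbrP.
have cL x : x \in W -> #|L x| = 4 * d by move=> xW; apply: card_pick_subset; apply: hdeg.
pose e0 : rel T := fun x y => [|| (x \in W) && (y \in L x) | (y \in W) && (x \in L y)].
have se0 : symmetric e0 by move=> x y; rewrite /e0 orbC.
have sub0 : subrel e0 e.
  by move=> x y /orP[] /andP[_ /LW /andP[_]] //; rewrite se.
have ie0 : irreflexive e0.
  by move=> x; apply/negP => /sub0; rewrite ie.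
have lo : 4 * d * #|W| <= arcs e0 W.
  rewrite mulnC -sum_nat_const; apply: leq_sum => x xW; rewrite -(cL x xW).
  apply: subset_leq_card; apply/subsetP => y yL; rewrite nbrP /e0 xW yL /=.
  by case/andP: (LW _ _ yL) => ->.
have hi : arcs e0 W <= 8 * d * #|W|.
  apply: leq_trans (_ : \sum_(x in W) (#|L x| + #|[set y in W | x \in L y]|) <= _).
    apply: leq_sum => x xW; apply: leq_trans (leq_card_setU _ _).
    apply: subset_leq_card; apply/subsetP => y.
    rewrite in_setU nbrP in_set => /andP[yW /orP[] /andP[_ h]]; first by rewrite h.
    by rewrite yW h orbT.
  rewrite big_split /=.
  have -> : \sum_(x in W) #|[set y in W | x \in L y]| = \sum_(y in W) #|L y|.
    under eq_bigr do rewrite -sum1_card.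
    rewrite (exchange_big_dep (mem W)) /=; last by move=> x y _; rewrite inE => /andP[].
    apply: eq_bigr => y yW; rewrite -sum1_card; apply: eq_bigl => x.
    rewrite inE yW /=; case xL: (x \in L y); rewrite ?andbF // andbT.
    by case/andP: (LW _ _ xL).
  rewrite (eq_bigr (fun=> 4 * d)); last by move=> x xW; apply: cL.
  by rewrite sum_nat_const; lia.
pose Y := [set x in W | 48 * D < #|nbr e0 W x|].
have sYW : Y \subset W by apply/subsetP => x; rewrite inE => /andP[].
have cY : #|Y| * (48 * D) <= 8 * d * #|W|.
  apply: leq_trans hi; rewrite -sum_nat_const /arcs [leqRHS](big_setID Y) /=.
  rewrite (setIidPr sYW); apply: leq_trans (leq_addr _ _).
  by apply: leq_sum => x; rewrite inE => /andP[_ /ltnW].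
have aY : arcs e0 Y <= 2 * D * #|Y|.
  have [Y0|Yn0] := eqVneq Y set0; first by rewrite /arcs Y0 big_set0.
  apply/ltnW/hD => //; apply: gmodel_sub => // x y _ _; exact: sub0.
pose U := [set u in W :\: Y | nbr e0 Y u != set0].
pose f u := odflt u [pick y in nbr e0 Y u].
have fU u : u \in U -> f u \in nbr e0 Y u.
  rewrite inE => /andP[_ /set0Pn[y yN]]; rewrite /f; case: pickP => //= /(_ y).
  by rewrite yN.
have sU : U \subset W :\: Y by apply/subsetP => u; rewrite inE => /andP[].
pose B y := y |: [set u in U | f u == y].
pose e1 : rel T := fun y z => (y != z) && [exists u in B y, exists v in B z, e u v].
have fe u : u \in U -> e u (f u).
  by move/fU; rewrite nbrP => /andP[_ /sub0].
have g1 : gmodel W e Y e1 by apply: (gmodel_stars (f := f) se sYW sU fe).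
have se1 : symmetric e1.
  move=> y z; rewrite /e1 eq_sym; congr (_ && _).
  by apply/exists_inP/exists_inP => -[u uB /exists_inP[v vB euv]]; exists v => //;
     apply/exists_inP; exists u; rewrite // se.
have ie1 : irreflexive e1 by move=> y; rewrite /e1 eqxx.
pose S := [set p : T * T | (p.1 \in U) && (p.2 \in nbr e0 Y p.1 :\ f p.1)].
have cS : #|S| + #|U| = \sum_(u in W :\: Y) #|nbr e0 Y u|.
  have -> : \sum_(u in W :\: Y) #|nbr e0 Y u| = \sum_(u in U) #|nbr e0 Y u|.
    rewrite big_mkcond [RHS]big_mkcond; apply: eq_bigr => u _; rewrite [u \in U]inE.
    by case: (u \in W :\: Y) => //=; case: eqP => //= ->; rewrite cards0.
  have -> : #|S| = \sum_(u in U) #|nbr e0 Y u :\ f u|.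
    under eq_bigr do rewrite -sum1_card.
    by rewrite pair_big_dep /= -sum1_card; apply: eq_bigl => -[x y] /=; rewrite inE.
  rewrite -sum1_card -big_split /=; apply: eq_bigr => u uU.
  by rewrite (cardsD1 (f u) (nbr e0 Y u)) (fU u uU) addnC.
have inS u y : ((u, y) \in S) = (u \in U) && (y \in nbr e0 Y u :\ f u) by rewrite inE.
have aS : #|S| <= arcs e1 Y.
  rewrite -pairs_arcs -(card_in_imset (f := fun p : T * T => (f p.1, p.2)) (D := mem S)).
    apply: subset_leq_card; apply/subsetP => _ /imsetP[[u y] uyS ->].
    have {uyS} : (u, y) \in S by [].
    rewrite [_ \in S]inS in_setD1 nbrP => /and3P[uU yf /andP[yY euy]].
    rewrite inE /= yY; have := fU u uU; rewrite nbrP => /andP[-> _] /=.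
    rewrite /e1 eq_sym yf /=; apply/exists_inP; exists u.
      by rewrite in_setU inE in_set uU eqxx orbT.
    by apply/exists_inP; exists y; [rewrite in_setU in_set1 eqxx | apply: sub0].
  move=> [u y] [v z] uyS vzS; have {uyS} : (u, y) \in S by [].
  have {vzS} : (v, z) \in S by [].
  rewrite !inS !in_setD1 !nbrP => /and3P[vU zf /andP[zY evz]] /and3P[uU yf /andP[yY euy]].
  case=> Ef Eyz; move: zf evz; rewrite -Eyz -Ef => zf evy; congr (_, _) => //.
  apply: (common_nbr_unique (x := f u) (y := y) se ie hg).
  - by rewrite eq_sym.
  - by rewrite se fe.
  - exact: sub0.
  - by rewrite Ef se fe.
  - exact: sub0.
have aY1 : arcs e1 Y <= 2 * D * #|Y|.
  have [Y0|Yn0] := eqVneq Y set0; first by rewrite /arcs Y0 big_set0.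
  exact/ltnW/hD.
have cUW : #|U| <= #|W|.
  by apply: subset_leq_card; apply: subset_trans sU (subsetDl _ _).
have split_nbr x : #|nbr e0 W x| = #|nbr e0 Y x| + #|nbr e0 (W :\: Y) x|.
  rewrite -(cardsID Y (nbr e0 W x)); congr addn; congr (#|pred_of_set _|).
    apply/setP => y; rewrite !inE; case yY: (_ && (_ < _)); rewrite ?andbF // andbT.
    by case/andP: yY => ->.
  by apply/setP => y; rewrite !inE andbA.
have split_arcs : arcs e0 W = arcs e0 Y + 2 * (\sum_(u in W :\: Y) #|nbr e0 Y u|) +
    arcs e0 (W :\: Y).
  have hS F : \sum_(x in W) F x = \sum_(x in Y) F x + \sum_(x in W :\: Y) F x.
    by rewrite (big_setID Y) /= (setIidPr sYW).
  rewrite {1}/arcs (eq_bigr _ (fun x _ => split_nbr x)) big_split /= !hS.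
  rewrite (sum_nbr_card Y (W :\: Y) se0) /arcs; lia.
(* At most 2D|Y| + 2(2D|Y| + |W|) arcs meet Y. The threshold 48D = 6 * 8D gives 6D|Y| <= d|W|, so
   with d >= 2 at most 2d|W| of the 4d|W| arcs are lost. *)
have big : 2 * d * #|W| <= arcs e0 (W :\: Y).
  have D48 : 6 * (D * #|Y|) <= d * #|W| by lia.
  have dW : 2 * #|W| <= d * #|W| by rewrite leq_mul2r d2 orbT.
  by move: split_arcs lo cS aS aY1 aY cUW; lia.
have WY0 : W :\: Y != set0.
  apply: contraTneq big => ->; rewrite /arcs big_set0 -ltnNge !muln_gt0 card_gt0 W0.
  by rewrite (ltn_trans _ d2).
have [|W' [sW' W'0 hW']] := min_degree_subset (d := d) se0 ie0 WY0.
  apply: leq_trans big; rewrite leq_mul2l subset_leq_card ?orbT //; exact: subsetDl.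
exists e0, W'; split=> //; first by apply: subset_trans sW' (subsetDl _ _).
move=> x xW'; rewrite hW' //=.
have := subsetP sW' _ xW'; rewrite !inE => /andP[h xW]; move: h; rewrite xW /= -leqNgt.
apply: leq_trans; apply: subset_leq_card; apply/subsetP => y; rewrite !nbrP => /andP[+ ->].
by move/(subsetP sW'); rewrite inE => /andP[_ ->].
Qed.

(** * Counting *)

(** Independence of the values of a uniformly random function, with denominators cleared. *)
Lemma card_ffun_constraints (T A : finType) (D : {set T}) (Q : T -> {set A}) :
  #|[set f : {ffun T -> A} | [forall x in D, f x \in Q x]]| * #|A| ^ #|D| =
  (\prod_(x in D) #|Q x|) * #|A| ^ #|T|.
Proof.
pose F x : {set A} := if x \in D then Q x else setT.
have -> : #|[set f : {ffun T -> A} | [forall x in D, f x \in Q x]]| = \prod_x #|F x|.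
  transitivity #|family F|; last by rewrite card_family foldrE big_map big_enum.
  apply: eq_card => f; rewrite inE; apply/forall_inP/familyP => h x.
    by rewrite /F; case: ifP => [/h|] //; rewrite inE.
  by move=> xD; have := h x; rewrite /F xD.
rewrite (bigID (mem D)) /= -mulnA; congr (_ * _).
  by apply: eq_bigr => x xD; rewrite /F xD.
rewrite (eq_bigr (fun=> #|A|)); last by move=> x /negPf xD; rewrite /F xD cardsT.
rewrite prod_nat_const -expnD; congr (_ ^ _).
by rewrite addnC -(cardC D).
Qed.

Lemma card_ffun_fixed (T : finType) (n : nat) (D : {set T}) (g : T -> nat) :
  #|[set f : {ffun T -> 'I_n} | [forall x in D, g x == f x]]| * n ^ #|D| <= n ^ #|T|.
Proof.
have := card_ffun_constraints D (fun x => [set a : 'I_n | g x == a]).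
rewrite card_ord => E.
have -> : #|[set f : {ffun T -> 'I_n} | [forall x in D, g x == f x]]| =
    #|[set f : {ffun T -> 'I_n} | [forall x in D, f x \in [set a : 'I_n | g x == a]]]|.
  by apply: eq_card => f; rewrite !inE; apply: eq_forallb => x; rewrite inE.
rewrite E -[leqRHS]mul1n leq_mul2r; apply/orP; right.
apply: leq_trans (_ : \prod_(x in D) 1 <= _); last by rewrite big1.
apply: leq_prod => x _; apply/card_le1_eqP => a b; rewrite !inE => /eqP ga /eqP gb.
by apply: val_inj; rewrite /= -ga -gb.
Qed.

Lemma card_exists_leq (I J : finType) (A : pred I) (P : I -> pred J) (m b : nat) :
  (forall i, A i -> #|[set x | P i x]| * m <= b) ->
  #|[set x | [exists i, A i && P i x]]| * m <= #|A| * b.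
Proof.
move=> h; apply: leq_trans (_ : (\sum_(i | A i) #|[set x | P i x]|) * m <= _).
  rewrite leq_mul2r; apply/orP; right; apply: leq_trans (card_bigcup_leq _ _).
  apply: subset_leq_card; apply/subsetP => x; rewrite inE => /existsP[i /andP[Ai Pi]].
  by apply/bigcupP; exists i => //; rewrite inE.
by rewrite big_distrl /= -sum_nat_const; apply: leq_sum.
Qed.

Lemma card_fibres_leq (I J : finType) (A : {set I}) (B : {set J}) (f : I -> J) (b : nat) :
  (forall i, i \in A -> f i \in B) ->
  (forall y, y \in B -> #|[set i in A | f i == y]| <= b) -> #|A| <= #|B| * b.
Proof.
move=> fAB hb; rewrite -sum1_card (partition_big f (mem B)) //= -sum_nat_const.
apply: leq_sum => y yB; apply: leq_trans (hb y yB); rewrite -sum1_card.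
by apply: eq_leq; apply: eq_bigl => i; rewrite !inE.
Qed.

Lemma card_chunk_leq (T : finType) (A : {set T}) (b j : nat) :
  0 < b -> #|[set a in A | index a (enum A) %/ b == j]| <= b.
Proof.
move=> b0.
pose idx a := index a (enum A).
set B := [set a in A | _].
have uB : uniq (map idx (enum B)).
  rewrite map_inj_in_uniq ?enum_uniq // => x y; rewrite !mem_enum !inE.
  move=> /andP[xA _] /andP[yA _] E.
  have h z : z \in A -> nth x (enum A) (idx z) = z by move=> zA; rewrite nth_index ?mem_enum.
  by rewrite -(h x xA) E h.
rewrite cardE -(size_map idx) -[leqRHS](size_iota (j * b)).
apply: uniq_leq_size => // i /mapP[a].
rewrite mem_enum inE => /andP[_ /eqP <-] ->.
by rewrite mem_iota leq_divM /= [in X in _ < X]addnC -mulSn ltn_ceil.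
Qed.

Lemma card_chunk_geq (T : finType) (A : {set T}) (b j : nat) :
  j.+1 * b <= #|A| -> b <= #|[set a in A | index a (enum A) %/ b == j]|.
Proof.
case: b => // b hA.
have [a0 _] : exists a, a \in A by apply/card_gt0P; apply: leq_trans hA.
pose f (i : 'I_b.+1) := nth a0 (enum A) (j * b.+1 + i).
have lt (i : 'I_b.+1) : j * b.+1 + i < size (enum A).
  by rewrite -cardE; have := ltn_ord i; move: hA; rewrite mulSn; lia.
have inf : injective f.
  move=> i i' /eqP; rewrite nth_uniq ?lt ?enum_uniq // eqn_add2l => /eqP E.
  exact: val_inj.
rewrite -[leqLHS]card_ord -cardsT -(card_imset _ inf); apply: subset_leq_card.
apply/subsetP => _ /imsetP[i _ ->]; rewrite inE -mem_enum mem_nth //=.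
by rewrite index_uniq ?lt ?enum_uniq // divnMDl // divn_small ?addn0 // ltn_ord.
Qed.

Lemma chunk_index_leq (T : finType) (A : {set T}) (b : nat) a :
  a \in A -> index a (enum A) %/ b * b < #|A|.
Proof.
move=> aA; apply: leq_ltn_trans (leq_divM _ _) _.
by rewrite cardE index_mem mem_enum.
Qed.

Lemma card_multiples_lt (N d M : nat) :
  0 < d -> d * #|[set g : 'I_N | g * d < M]| <= M + d.
Proof.
move=> d0; apply: leq_trans (_ : d * (M %/ d).+1 <= _); last first.
  by rewrite mulnS addnC leq_add2r mulnC leq_divM.
rewrite leq_mul2l orbC; apply/orP; left.
rewrite cardE -(size_map val) -[leqRHS](size_iota 0); apply: uniq_leq_size.
  by rewrite map_inj_uniq ?enum_uniq //; apply: val_inj.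
move=> i /mapP[g]; rewrite mem_enum inE => gM ->.
by rewrite mem_iota /= add0n ltnS leq_divRL // ltnW.
Qed.

(** Bernoulli's inequality (1 - 1/d)^n >= 1 - n/d. *)
Lemma expn_pred_bernoulli (d n : nat) : n <= d -> d ^ n * (d - n) <= d * d.-1 ^ n.
Proof.
case: d => [|d] /=; first by case: n.
elim: n => [|n IHn] nd; first by rewrite !expn0 subn0 mul1n muln1.
rewrite !expnS.
apply: leq_trans (_ : d * (d.+1 ^ n * (d.+1 - n)) <= _); last first.
  by rewrite [leqRHS]mulnCA leq_mul2l IHn ?orbT // ltnW.
rewrite [leqRHS]mulnCA mulnAC mulnC leq_mul2l; apply/orP; right.
have [m ->] : exists m, d = n + m by exists (d - n); rewrite subnKC.
have -> : (n + m).+1 - n.+1 = m by lia.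
have -> : (n + m).+1 - n = m.+1 by lia.
by nia.
Qed.

(** A rational substitute for (1 - 1/N)^m <= exp(-m/N): Bernoulli's inequality for (1 + 1/(N-1))^m,
    inverted. *)
Lemma expn_pred_upper (N m : nat) : 0 < N -> N.-1 ^ m * (N.-1 + m) <= N ^ m * N.-1.
Proof.
case: N => // N _ /=; elim: m => [|m IHm]; first by rewrite addn0.
rewrite !expnS -mulnA.
apply: leq_trans (_ : N.+1 * (N ^ m * (N + m)) <= _); last first.
  by rewrite -mulnA leq_mul2l IHm orbT.
rewrite mulnCA [leqRHS]mulnCA leq_mul2l; apply/orP; right; nia.
Qed.

(* On a fibre of size m this is 2 K m <= K^2 + m^2. *)
Lemma collision_count (P R : finType) (M : {set P}) (h : P -> R) (K : nat) :
  2 * K * #|M| <= K ^ 2 * #|h @: M| + #|M| +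
    #|[set p : P * P | [&& p.1 \in M, p.2 \in M, p.1 != p.2 & h p.1 == h p.2]]|.
Proof.
pose F y := [set p in M | h p == y].
have sM : #|M| = \sum_(y in h @: M) #|F y|.
  rewrite -sum1_card (partition_big h (mem (h @: M))) /=; last by move=> p; apply: imset_f.
  by apply: eq_bigr => y _; rewrite -sum1_card; apply: eq_bigl => p; rewrite !inE.
pose E := [set p : P * P | [&& p.1 \in M, p.2 \in M & h p.1 == h p.2]].
have cE : #|E| = \sum_(y in h @: M) #|F y| ^ 2.
  rewrite -sum1_card (partition_big (fun p => h p.1) (mem (h @: M))) /=; last first.
    by move=> p; rewrite inE => /andP[pM _]; apply: imset_f.
  apply: eq_bigr => y _; rewrite -mulnn -cardsX -sum1_card; apply: eq_bigl => -[p p'].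
  rewrite !inE /=; case: (p \in M); case: (p' \in M) => //=; rewrite ?andbF //.
  by case: (h p =P y) => [->|_] /=; rewrite ?andbF // andbT eq_sym.
rewrite -addnA; have -> : #|M| + #|[set p : P * P | [&& p.1 \in M, p.2 \in M, p.1 != p.2 & h p.1 == h p.2]]| = #|E|.
  rewrite -(card_imset (mem M) (f := fun p => (p, p))); last by move=> p p' [].
  rewrite -(cardsID [set p | p.1 == p.2] E); congr addn; congr (#|pred_of_set _|).
    apply/setP => -[p p']; rewrite !inE /=; apply/imsetP/idP.
      by case=> x xM [-> ->]; rewrite !eqxx xM.
    by case/andP=> /and3P[pM _ _] /eqP <-; exists p.
  apply/setP => -[p p']; rewrite !inE /=; case: (p != p'); rewrite ?andbF //=.
rewrite cE sM big_distrr /= [K ^ 2 * _]mulnC -sum_nat_const -big_split /=.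
by apply: leq_sum => y _; have := (nat_Cauchy K #|F y|).1; rewrite mulnA.
Qed.

(** * Contracting the trees of a rooted forest *)

Definition forest_cell (T : finType) (par : T -> T) (lev : T -> nat) (v : T) : T :=
  iter (lev v) par v.

Definition forest_adj (T : finType) (e : rel T) (A : {set T}) (rt : T -> T) : rel T :=
  fun x y => (x != y) && [exists u in A, exists v in A,
    [&& rt u == x, rt v == y & e u v]].

Lemma forest_adj_sym (T : finType) (e : rel T) (A : {set T}) (rt : T -> T) :
  symmetric e -> symmetric (forest_adj e A rt).
Proof.
move=> se x y; rewrite /forest_adj eq_sym; congr (_ && _).
by apply/exists_inP/exists_inP => -[u uA /exists_inP[v vA /and3P[h1 h2 h3]]]; exists v => //;
  apply/exists_inP; exists u; rewrite // h1 h2 se.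
Qed.

(** The level drops by one along [par], so a vertex and its parent have the same root, and every
    cell is connected through its root. *)
Lemma forest_gmodel (T : finType) (e : rel T) (W A : {set T}) (par : T -> T)
    (lev : T -> nat) :
  symmetric e -> A \subset W ->
  (forall v, v \in A -> 0 < lev v ->
     [/\ par v \in A, (lev (par v)).+1 = lev v & e v (par v)]) ->
  gmodel W e [set x in A | lev x == 0] (forest_adj e A (forest_cell par lev)).
Proof.
move=> se sAW hpar; set rt := forest_cell par lev.
exists (fun x => [set v in A | rt v == x]); split.
- move=> x; rewrite inE => /andP[xA /eqP x0]; split.
    by apply: subset_trans sAW; apply/subsetP => v; rewrite inE => /andP[].
  by apply/set0Pn; exists x; rewrite inE xA /rt /forest_cell x0 /=.
- move=> x _; apply: (conn_root (r := x)) => // v; rewrite inE => /andP[vA /eqP].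
  rewrite /rt /forest_cell; move: {2}(lev v) (erefl (lev v)) => n.
  elim: n v vA => [|n IHn] v vA lv; first by rewrite lv /= => ->; apply: connect0.
  have v0 : 0 < lev v by rewrite lv.
  have [pA lp ep] := hpar v vA v0.
  move=> rv; have lp' : lev (par v) = n by move: lp; rewrite lv => -[].
  have rp : iter (lev (par v)) par (par v) = x by rewrite lp' -iterSr -lv.
  apply: connect_trans (IHn _ pA lp' rp); apply: connect1.
  by rewrite /in_rel /= !inE vA pA rp rv eqxx.
- move=> x y _ _ xy; rewrite disjoint_subset; apply/subsetP => v; rewrite !inE.
  by move=> /andP[vA /eqP->]; rewrite vA.
move=> x y _ _ /andP[_ /exists_inP[u uA /exists_inP[v vA /and3P[/eqP ux /eqP vy euv]]]].
by exists u, v; rewrite !inE uA vA ux vy !eqxx.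
Qed.

(** * Counting walks by out-degree *)

Lemma card_path_tuples (T : finType) (r : rel T) (W : {set T}) (d n : nat) u :
  (forall x y, x \in W -> r x y -> y \in W) ->
  (forall x, x \in W -> #|[set y | r x y]| <= d) ->
  u \in W -> #|[set p : n.-tuple T | path r u p]| <= d ^ n.
Proof.
move=> rW rd; elim: n u => [|n IHn] u uW.
  by apply: leq_trans (max_card _) _; rewrite card_tuple expn0.
pose F := [set ap : T * n.-tuple T | r u ap.1 && path r ap.1 ap.2].
have inf : injective (fun p : n.+1.-tuple T => (thead p, behead_tuple p)).
  by move=> p p' [h1 h2]; rewrite (tuple_eta p) (tuple_eta p'); apply: val_inj; rewrite /= h1 h2.
rewrite -(card_imset _ inf); apply: leq_trans (_ : #|F| <= _).
  apply: subset_leq_card; apply/subsetP => _ /imsetP[p + ->]; rewrite !inE /=.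
  by rewrite {1}(tuple_eta p).
have -> : #|F| = \sum_(a in [set y | r u y]) #|[set p : n.-tuple T | path r a p]|.
  under eq_bigr do rewrite -sum1_card.
  by rewrite pair_big_dep /= -sum1_card; apply: eq_bigl => -[a p]; rewrite !inE.
rewrite expnS; apply: leq_trans (_ : \sum_(a in [set y | r u y]) d ^ n <= _).
  by apply: leq_sum => a; rewrite inE => ra; apply: IHn; apply: rW ra.
by rewrite sum_nat_const leq_mul2r rd ?orbT.
Qed.

Lemma card_nonbacktracking_tuples (T : finType) (r : rel T) (W : {set T}) (d n : nat) v u :
  (forall x y, x \in W -> r x y -> y \in W) ->
  (forall x, x \in W -> d <= #|[set y | r x y]|) ->
  u \in W ->
  d.-1 ^ n <= #|[set p : n.-tuple T | path r u p && nonbacktracking (v :: u :: p)]|.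
Proof.
move=> rW rd; elim: n v u => [|n IHn] v u uW.
  rewrite expn0; apply/card_gt0P; exists [tuple]; by rewrite inE.
pose F := [set ap : T * n.-tuple T |
  [&& r u ap.1, ap.1 != v & path r ap.1 ap.2 && nonbacktracking (u :: ap.1 :: ap.2)]].
have inf : injective (fun ap : T * n.-tuple T => cons_tuple ap.1 ap.2).
  by move=> [a p] [b p'] /(congr1 val) /= [-> /val_inj ->].
apply: leq_trans (_ : #|F| <= _); last first.
  rewrite -(card_imset _ inf); apply: subset_leq_card.
  apply/subsetP => _ /imsetP[[a p] + ->]; rewrite !inE => /and3P[/= -> av /andP[-> h]].
  by rewrite eq_sym av.
have -> : #|F| = \sum_(a in [set y | r u y] :\ v)
    #|[set p : n.-tuple T | path r a p && nonbacktracking (u :: a :: p)]|.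
  under eq_bigr do rewrite -sum1_card.
  rewrite pair_big_dep /= -sum1_card; apply: eq_bigl => -[a p].
  by rewrite !inE [(a, p).1]/= [(a, p).2]/= -andbA andbCA.
apply: leq_trans (_ : \sum_(a in [set y | r u y] :\ v) d.-1 ^ n <= _); last first.
  by apply: leq_sum => a; rewrite !inE => /andP[_ ra]; apply: IHn; apply: rW ra.
rewrite sum_nat_const expnS leq_mul2r; apply/orP; right.
by have := rd u uW; rewrite (cardsD1 v); case: (v \in _); lia.
Qed.

(** * Random cells *)

(* Cells have radius k.+1, and walks follow the out-neighbour lists L.  A vertex x
   may have many in-neighbours; they are divided into groups of at most d, and the
   label c x in 'I_N selects one group.  Only arcs from the selected group may
   enter the hub x, so that x acts as a vertex of in-degree d, while an arc into x
   is selected with probability exactly 1/N; x is a hub if the selected group is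
   nonempty.  The list L v is divided into s blocks of 8 s vertices, and the label
   j v in 'I_s says through which block v joins a cell at distance k.+1: this
   bounds the probability of each possible choice by 1/s. *)
Section RandomForest.

Variables (T : finType) (e : rel T) (W : {set T}) (L : T -> {set T}) (k s big : nat).
Definition out_degree : nat := 8 * s * s.
Definition label_count : nat := s * out_degree ^ k.
Local Notation d := out_degree.
Local Notation N := label_count.

Hypothesis e_sym : symmetric e.
Hypothesis e_irr : irreflexive e.
Hypothesis e_girth : girth_ge e (4 * k.+1 + 1).
Hypothesis big_gt0 : 0 < big.
Hypothesis s_gt0 : 0 < s.
Hypothesis L_nbr : forall v, v \in W -> L v \subset nbr e W v.
Hypothesis card_L : forall v, v \in W -> #|L v| = d.

Definition in_nbr (x : T) : {set T} := [set v in W | x \in L v].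

(** It ensures that N labels suffice for the groups and, once [big * k.+1 <= N], that x is a hub
    with probability at most 2/([big * k.+1]), small enough for a union bound along a walk. *)
Hypothesis in_nbr_bound : forall x, x \in W -> big * k.+1 * #|in_nbr x| <= N * d.

Definition block (v w : T) : nat := index w (enum (L v)) %/ (8 * s).
Definition group (v x : T) : nat := index v (enum (in_nbr x)) %/ d.

Lemma d_gt0 : 0 < d. Proof. by rewrite !muln_gt0 s_gt0. Qed.
Lemma N_gt0 : 0 < N. Proof. by rewrite muln_gt0 s_gt0 expn_gt0 d_gt0. Qed.

Lemma L_W v w : v \in W -> w \in L v -> w \in W.
Proof. by move=> vW /(subsetP (L_nbr vW)); rewrite nbrP => /andP[]. Qed.

Lemma L_adj v w : v \in W -> w \in L v -> e v w.
Proof. by move=> vW /(subsetP (L_nbr vW)); rewrite nbrP => /andP[]. Qed.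

Lemma group_lt_in v x : v \in W -> x \in L v -> group v x * d < #|in_nbr x|.
Proof. by move=> vW xL; apply: chunk_index_leq; rewrite inE vW. Qed.

Lemma group_lt v x : v \in W -> x \in L v -> group v x < N.
Proof.
move=> vW xL; rewrite -(ltn_pmul2r d_gt0); apply: leq_trans (group_lt_in vW xL) _.
apply: leq_trans (in_nbr_bound (L_W vW xL)); by apply: leq_pmull; rewrite muln_gt0 big_gt0.
Qed.

(** * The cells for fixed labels *)

Section Labels.

Variables (c : {ffun T -> 'I_N}) (j : {ffun T -> 'I_s}).

Definition hubs : {set T} := [set x in W | c x * d < #|in_nbr x|].

(* A walk of i.+1 arcs from v whose last arc is selected by its end, with no hub
   before the end. *)
Fixpoint reach (i : nat) (v : T) : bool :=
  (v \notin hubs) &&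
  [exists w in L v, if i is i'.+1 then reach i' w else group v w == c w].

Definition enters (i : nat) (v w : T) : bool :=
  if i is i'.+1 then reach i' w else group v w == c w.

Lemma reachE i v : reach i v = (v \notin hubs) && [exists w in L v, enters i v w].
Proof. by case: i. Qed.

(* The value k.+2 means that no hub is reached in k.+1 steps. *)
Definition level (v : T) : nat :=
  if v \in hubs then 0 else (find (reach^~ v) (iota 0 k.+1)).+1.

Lemma level_eq0 v : (level v == 0) = (v \in hubs).
Proof. by rewrite /level; case: ifP. Qed.

Lemma level_min v i : level v = i.+1 -> i <= k ->
  [/\ v \notin hubs, reach i v & forall i', i' < i -> ~~ reach i' v].
Proof.
rewrite /level; case: ifP => // vh /succn_inj fi ik; split=> //.
  have hs : has (reach^~ v) (iota 0 k.+1) by rewrite has_find fi size_iota ltnS.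
  by have := nth_find 0 hs; rewrite fi nth_iota.
move=> i' ii'; have := @before_find _ 0 (reach^~ v) (iota 0 k.+1) i'.
rewrite fi ii' nth_iota; last by lia.
by move=> /(_ isT) /= ->.
Qed.

Lemma level_intro v i : i <= k -> reach i v -> (forall i', i' < i -> ~~ reach i' v) ->
  level v = i.+1.
Proof.
move=> ik ri hm; rewrite /level; have := ri; rewrite reachE => /andP[/negPf-> _].
congr _.+1; set F := find _ _.
have hs : has (reach^~ v) (iota 0 k.+1).
  by apply/hasP; exists i => //; rewrite mem_iota.
have Fk : F < k.+1 by move: hs; rewrite has_find size_iota.
have rF : reach F v by have := nth_find 0 hs; rewrite -/F nth_iota.
have [Fi|iF|//] := ltngtP F i; first by have := hm _ Fi; rewrite rF.
have := @before_find _ 0 (reach^~ v) (iota 0 k.+1) i iF.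
by rewrite nth_iota // add0n ri.
Qed.

(** A shorter walk from w to a hub would extend to a shorter one from v. For i = 0, the selected
    group is nonempty as it contains v, so w is a hub. *)
Lemma level_enters v w i : v \in W -> w \in L v -> level v = i.+1 -> i <= k ->
  enters i v w -> level w = i.
Proof.
move=> vW wL lv ik en; have [vh ri hm] := level_min lv ik.
case: i => [|i] /= in lv ik en ri hm *.
  apply/eqP; rewrite level_eq0 inE (L_W vW wL) /= -(eqP en).
  exact: group_lt_in.
apply: level_intro => //; first exact: ltnW.
move=> i' i'i; have := hm i'.+1 i'i; apply: contra => r.
by rewrite reachE vh; apply/exists_inP; exists w.
Qed.

(** The block label constrains level [k.+1] only. Parents have smaller level, so they are assigned
    automatically and the cells are closed under [parent]. *)
Definition assigned : {set T} := [set v in W | (level v <= k.+1) &&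
  ((level v == k.+1) ==> [exists w in L v, (block v w == j v) && enters k v w])].

Definition parent (v : T) : T :=
  odflt v [pick w in L v | enters (level v).-1 v w &&
                           ((level v == k.+1) ==> (block v w == j v))].

Lemma parentP v : v \in assigned -> 0 < level v ->
  [/\ parent v \in L v, enters (level v).-1 v (parent v) &
      level v = k.+1 -> block v (parent v) = j v].
Proof.
rewrite inE => /and3P[vW lk /implyP bl] l0; rewrite /parent.
case: pickP => [w /and3P[wL en /implyP h]|] /=.
  by split=> // lv; apply/eqP/h; rewrite lv.
have [lv|lv] := eqVneq (level v) k.+1.
  have /exists_inP[w wL /andP[bw en]] := bl (introT eqP lv).
  by move/(_ w); rewrite lv wL en bw implybT.
have lv1 : level v = (level v).-1.+1 by rewrite prednK.
have ik : (level v).-1 <= k by move: lk lv; lia.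
have [_ + _] := level_min lv1 ik.
rewrite reachE => /andP[_ /exists_inP[w wL en]] /(_ w).
by rewrite wL en.
Qed.

Lemma assigned_W v : v \in assigned -> v \in W.
Proof. by rewrite inE => /andP[]. Qed.

Lemma level_parent v : v \in assigned -> 0 < level v -> (level (parent v)).+1 = level v.
Proof.
move=> vA l0; have [pL en _] := parentP vA l0; have vW := assigned_W vA.
have lk : level v <= k.+1 by move: vA; rewrite inE => /and3P[].
rewrite -[RHS](prednK l0); congr _.+1.
by apply: (level_enters vW pL) => //; rewrite ?prednK // -ltnS prednK.
Qed.

Lemma parent_assigned v : v \in assigned -> 0 < level v -> parent v \in assigned.
Proof.
move=> vA l0; have [pL _ _] := parentP vA l0; have vW := assigned_W vA.
have lk : level v <= k.+1 by move: vA; rewrite inE => /and3P[].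
have lp := level_parent vA l0.
rewrite inE (L_W vW pL) /=; apply/andP; split; first by rewrite -lp in lk; lia.
by apply/implyP => /eqP E; rewrite -lp E ltnn in lk.
Qed.

Definition root : T -> T := forest_cell parent level.

Lemma hubs_gmodel : gmodel W e hubs (forest_adj e assigned root).
Proof.
have -> : hubs = [set x in assigned | level x == 0].
  apply/setP => x; rewrite [RHS]in_set -level_eq0 andb_idl // => /eqP l0.
  have : x \in hubs by rewrite -level_eq0 l0.
  by rewrite [x \in hubs]inE inE l0 => /andP[->].
apply: forest_gmodel => //; first by apply/subsetP => v; apply: assigned_W.
move=> v vA l0; split; [exact: parent_assigned | exact: level_parent|].
by apply: (L_adj (assigned_W vA)); case: (parentP vA l0).
Qed.

(** Restricting to the top level gives all walks to the hubs the same length, so that every counted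
    arc lies on a path of length 2k+3 between hubs. *)
Definition full (v : T) : bool := (v \in assigned) && (level v == k.+1).

Definition full_arcs : {set T * T} :=
  [set p | [&& p.1 \in W, p.2 \in L p.1, full p.1 & full p.2]].

Lemma iter_parent v i : v \in assigned -> i <= level v ->
  iter i parent v \in assigned /\ level (iter i parent v) = level v - i.
Proof.
move=> vA; elim: i => [|i IHi] il; first by rewrite subn0.
have [iA li] := IHi (ltnW il); rewrite iterS.
have l0 : 0 < level (iter i parent v) by rewrite li subn_gt0.
by split; [apply: parent_assigned | have := level_parent iA l0; rewrite li; lia].
Qed.

Lemma path_parent v n : v \in assigned -> n <= level v ->
  path (fun x y => y \in L x) v (traject parent (parent v) n).
Proof.
elim: n v => //= n IHn v vA nl; have l0 : 0 < level v by lia.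
have [-> _ _] := parentP vA l0; apply: IHn; first exact: parent_assigned.
by rewrite -ltnS level_parent.
Qed.

(** Levels strictly decrease along parents, and x, having level at least that of v, is not the
    parent of v. *)
Lemma nonbacktracking_parent x v n : v \in assigned -> n <= level v ->
  level v <= level x -> nonbacktracking (x :: v :: traject parent (parent v) n).
Proof.
elim: n x v => // n IHn x v vA nl lx; have l0 : 0 < level v by lia.
have lp := level_parent vA l0.
rewrite trajectS [X in is_true X]/=; apply/andP; split.
  by apply: contraTneq lx => ->; rewrite -ltnNge -lp.
apply: IHn; first exact: parent_assigned.
  by rewrite -ltnS lp.
by rewrite -lp.
Qed.

End Labels.

(** * Collisions: arcs joining the same two cells *)

Lemma path_L_e v p : v \in W -> path (fun x y => y \in L x) v p -> path e v p.
Proof.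
elim: p v => //= w p IHp v vW /andP[wL pp].
by rewrite (L_adj vW wL) IHp // (L_W vW wL).
Qed.

Lemma path_L_W v p : v \in W -> path (fun x y => y \in L x) v p -> last v p \in W.
Proof.
elim: p v => //= w p IHp v vW /andP[wL pp]; exact: IHp (L_W vW wL) pp.
Qed.

(* (u, v, p, q): an arc from u to v, with walks p from u and q from v to hubs. *)
Definition config : finType := (T * T * k.+1.-tuple T * k.+1.-tuple T)%type.

(** For p of length [k.+1], index k of [u :: p] is the last place but one. *)
Definition penult (u : T) (p : seq T) : T := nth u (u :: p) k.

Definition valid (P : config) : bool :=
  let: (u, v, p, q) := P in
  [&& u \in W, v \in L u,
      path (fun x y => y \in L x) u p, path (fun x y => y \in L x) v q,
      nonbacktracking (v :: u :: p) & nonbacktracking (u :: v :: q)].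

(** Equality of the groups is forced when one labelling realises both: each equals the label of the
    common hub. *)
Definition compatible (P P' : config) : bool :=
  let: (u, v, p, q) := P in let: (u', v', p', q') := P' in
  [&& last u p == last u' p', last v q == last v' q',
      group (penult u p) (last u p) == group (penult u' p') (last u' p'),
      group (penult v q) (last v q) == group (penult v' q') (last v' q') & P != P'].

Definition realised (c : {ffun T -> 'I_N}) (j : {ffun T -> 'I_s}) (P : config) : bool :=
  let: (u, v, p, q) := P in
  [&& group (penult u p) (last u p) == c (last u p),
      group (penult v q) (last v q) == c (last v q),
      block u (head u p) == j u & block v (head v q) == j v].

Definition out_arcs : {set T * T} := [set p | (p.1 \in W) && (p.2 \in L p.1)].

Lemma card_out_arcs : #|out_arcs| = #|W| * d.
Proof.
rewrite -sum_nat_const -(eq_bigr _ (fun v vW => card_L vW)).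
under eq_bigr do rewrite -sum1_card.
by rewrite pair_big_dep /= -sum1_card; apply: eq_bigl => -[x y]; rewrite inE.
Qed.

Lemma card_valid : #|[set P | valid P]| <= #|W| * d * (d ^ k.+1 * d ^ k.+1).
Proof.
pose A u := [set p : k.+1.-tuple T | path (fun x y => y \in L x) u p].
have cA u : u \in W -> #|A u| <= d ^ k.+1.
  move=> uW; apply: (card_path_tuples (W := W)) => //; first exact: L_W.
  by move=> x xW; rewrite cardsE -/(mem (L x)) (card_L xW).
rewrite -card_out_arcs; apply: (card_fibres_leq (f := fun P : config => P.1.1)).
  by move=> [[[u v] p] q]; rewrite !inE /= => /and3P[-> ->].
move=> [u v]; rewrite inE /= => /andP[uW vL]; have vW := L_W uW vL.
apply: leq_trans (leq_mul (cA u uW) (cA v vW)); rewrite -cardsX.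
rewrite -(card_in_imset (f := fun P : config => (P.1.2, P.2))).
  apply: subset_leq_card; apply/subsetP => _ /imsetP[[[[u' v'] p] q] + ->].
  rewrite !inE /= => /andP[/and5P[_ _ pp qq _] /eqP [Eu Ev]].
  by rewrite -Eu -Ev; apply/andP.
move=> [[[u1 v1] p1] q1] [[[u2 v2] p2] q2]; rewrite !inE /=.
by move=> /andP[_ /eqP[-> ->]] /andP[_ /eqP[-> ->]] [-> ->].
Qed.

(* Together with the arc u v both walks form a path of length 2k+3 between the
   hubs; two such paths with a common first edge would give a cycle of length at
   most 4k+4. *)
Lemma valid_equal (u v u' v' : T) (p q p' q' : k.+1.-tuple T) :
  valid (u, v, p, q) -> valid (u', v', p', q') ->
  last u p = last u' p' -> last v q = last v' q' -> penult u p = penult u' p' ->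
  (u, v, p, q) = (u', v', p', q').
Proof.
have split_path (w z : T) (a b : k.+1.-tuple T) : valid (w, z, a, b) ->
    exists2 G, catrev a (w :: z :: b) = last w a :: penult w a :: G &
      [&& path e (penult w a) G, nonbacktracking (penult w a :: G),
          last (penult w a) G == last z b & size G == k + k + 2].
  move=> /and5P[wW zL pa pb /andP[na nb]]; have zW := L_W wW zL.
  have ewz := L_adj wW zL.
  have sF : sorted e (catrev a (w :: z :: b)).
    apply: sorted_catrev => //; first exact: path_L_e.
    by rewrite /= ewz path_L_e.
  have nF := nonbacktracking_catrev na nb.
  have sa : size a = k.+1 by rewrite size_tuple.
  have sb : size b = k.+1 by rewrite size_tuple.
  move: sF nF; rewrite catrevE.
  have -> : rev a ++ w :: z :: b = rev (w :: a) ++ z :: b by rewrite rev_cons cat_rcons.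
  have wa : w :: a = rcons (rcons (take k (w :: a)) (penult w a)) (last w a).
    rewrite /penult -take_nth ?[size _]/= ?sa ?ltnS //.
    have -> : take k.+1 (w :: a) = belast w a.
      by rewrite lastI -cats1 take_size_cat // size_belast.
    exact: lastI.
  rewrite wa !rev_rcons => sF nF.
  exists (rev (take k (w :: a)) ++ z :: b) => //.
  have pG := path_sorted sF.
  apply/and4P; split; [exact: pG | exact: nonbacktracking_behead nF | by rewrite last_cat |].
  rewrite size_cat size_rev size_takel /= ?sb; first by rewrite -addnA addn2.
  by rewrite sa ltnW.
move=> V V' Ex Ey Ea.
have [G EG /and4P[pG nG /eqP lG /eqP sG]] := split_path _ _ _ _ V.
have [G' EG' /and4P[pG' nG' /eqP lG' /eqP sG']] := split_path _ _ _ _ V'.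
rewrite -Ea in EG' pG' nG' lG'.
have E : G = G'.
  apply: (nonbacktracking_unique e_sym e_irr e_girth pG pG' nG nG').
    by rewrite lG lG'.
  by rewrite sG sG'; clear; lia.
have : catrev p (u :: v :: q) = catrev p' (u' :: v' :: q') by rewrite EG EG' Ex E.
move/eqP; rewrite !catrevE eqseq_cat ?size_rev ?size_tuple //.
case/andP => /eqP/(can_inj revK)/val_inj -> /eqP[-> ->].
by move/val_inj->.
Qed.

(** Nonbacktracking walks with common ends coincide when short compared with the girth. So u = u' or
    v = v' would make the configurations equal, while u = v' or v = u' would equate walks of lengths
    [k.+1] and [k.+2]. The four block labels are therefore independent. *)
Lemma valid_apart (u v u' v' : T) (p q p' q' : k.+1.-tuple T) :
  valid (u, v, p, q) -> valid (u', v', p', q') ->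
  last u p = last u' p' -> last v q = last v' q' ->
  (u, v, p, q) != (u', v', p', q') ->
  uniq [:: u; v; u'; v'].
Proof.
move=> V V' Ex Ey neq.
have facts (w z : T) (a b : k.+1.-tuple T) : valid (w, z, a, b) ->
   [/\ path e w a, path e z b, e w z, nonbacktracking (z :: w :: a) &
     nonbacktracking (w :: z :: b)].
  move=> /and5P[wW zL pa pb /andP[na nb]]; have zW := L_W wW zL.
  by split=> //; [apply: path_L_e | apply: path_L_e | apply: L_adj].
have [pu pv uv nu nv] := facts _ _ _ _ V.
have [pu' pv' uv' nu' nv'] := facts _ _ _ _ V'.
have U := nonbacktracking_unique e_sym e_irr e_girth.
have sz (a : k.+1.-tuple T) : size a = k.+1 by rewrite size_tuple.
have uu' : u != u'.
  apply: contraNneq neq => E; rewrite -E in Ex nu' nv' pu' uv' *.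
  have Ep : val p = val p'.
    by apply: (U u) => //; [apply: nonbacktracking_behead nu |
      apply: nonbacktracking_behead nu' | rewrite !sz; (clear; lia)].
  have [Ev Eq] : v = v' /\ val q = val q'.
    have : v :: q = v' :: q' by apply: (U u) => //=; rewrite ?uv ?uv' ?sz //; (clear; lia).
    by case.
  by rewrite Ev (val_inj Ep) (val_inj Eq).
have vv' : v != v'.
  apply: contraNneq neq => E; rewrite -E in Ey nu' nv' pv' uv' *.
  have Eq : val q = val q'.
    by apply: (U v) => //; [apply: nonbacktracking_behead nv |
      apply: nonbacktracking_behead nv' | rewrite !sz; (clear; lia)].
  have [Eu Ep] : u = u' /\ val p = val p'.
    have : u :: p = u' :: p'.
      by apply: (U v) => //=; rewrite ?(e_sym v) ?uv ?uv' ?sz //; (clear; lia).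
    by case.
  by rewrite Eu (val_inj Ep) (val_inj Eq).
have uv'' : u != v'.
  apply/eqP => E; rewrite -E in nu' nv' pv' uv'.
  have : val p = u' :: p'.
    apply: (U u) => //=; [by rewrite e_sym uv' | exact: nonbacktracking_behead nu |].
    by rewrite !sz; (clear; lia).
  by move/(congr1 size); rewrite /= !sz; (clear; lia).
have vu' : v != u'.
  apply/eqP => E; rewrite -E in nu' nv' pu' uv' Ex.
  have : u :: p = val p'.
    apply: (U v) => //=; [by rewrite e_sym uv | exact: nonbacktracking_behead nu' |].
    by rewrite !sz; (clear; lia).
  by move/(congr1 size); rewrite /= !sz; (clear; lia).
have uv1 : u != v by apply: contraTneq uv => ->; rewrite e_irr.
have uv1' : u' != v' by apply: contraTneq uv' => ->; rewrite e_irr.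
by rewrite /= !inE !negb_or uv1 uu' uv'' vu' vv' uv1'.
Qed.

Lemma valid_ends (u v : T) (p q : k.+1.-tuple T) :
  valid (u, v, p, q) -> last u p != last v q.
Proof.
move=> /and5P[uW vL pa pb /andP[na nb]]; have vW := L_W uW vL.
apply/eqP => E; have : val p = v :: q.
  apply: (nonbacktracking_unique e_sym e_irr e_girth (x := u)) => //=.
  - exact: path_L_e.
  - by rewrite L_adj // path_L_e.
  - exact: nonbacktracking_behead na.
  - by rewrite !size_tuple; (clear; lia).
by move/(congr1 size); rewrite /= !size_tuple; (clear; lia).
Qed.

Lemma penult_L u (p : k.+1.-tuple T) : u \in W -> path (fun x y => y \in L x) u p ->
  penult u p \in W /\ last u p \in L (penult u p).
Proof.
move=> uW; rewrite /penult -nth_last size_tuple /= => pp.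
have sp : k < size p by rewrite size_tuple.
split; first last.
  exact: (pathP u pp k sp).
have h i : i < size p -> nth u (u :: p) i \in W.
  elim: i => [|i IHi] //= ip; apply: (L_W (IHi (ltnW ip))).
  by have := pathP u pp i (ltnW ip).
exact: h.
Qed.

(** Given the first configuration, the second is determined by its penultimate vertex before the
    first hub ([valid_equal]), and that vertex lies in a known group of at most d vertices. *)
Lemma card_compatible :
  #|[set PP : config * config | [&& valid PP.1, valid PP.2 & compatible PP.1 PP.2]]|
    <= #|W| * d * (d ^ k.+1 * d ^ k.+1) * d.
Proof.
apply: leq_trans (leq_mul card_valid (leqnn d)).
apply: (card_fibres_leq (f := fst)); first by move=> PP; rewrite !inE => /and3P[].
move=> [[[u v] p] q]; rewrite inE => V.
pose B := [set a in in_nbr (last u p) |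
  group a (last u p) == group (penult u p) (last u p)].
apply: leq_trans (_ : #|B| <= _); last by apply: card_chunk_leq; apply: d_gt0.
pose g (PP : config * config) := let: (_, (u', _, p', _)) := PP in penult u' p'.
rewrite -(card_in_imset (f := g)).
  apply: subset_leq_card; apply/subsetP => _ /imsetP[[P [[[u' v'] p'] q']] + ->].
  rewrite inE => /andP[+ /eqP /= EP]; rewrite inE EP => /and3P[_ V' /and5P[/eqP Ex _ Eg _ _]].
  have /and5P[uW' _ pp' _ _] := V'.
  have [pW pL] := penult_L uW' pp'.
  by rewrite !inE pW Ex pL -Ex (eqP Eg) -Ex /= eqxx.
move=> [P [[[u1 v1] p1] q1]] [P' [[[u2 v2] p2] q2]].
rewrite !inE => /andP[+ /eqP /= EP] /andP[+ /eqP /= EP']; rewrite EP EP' /=.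
move=> /and3P[_ V1 /and5P[/eqP Ex1 /eqP Ey1 _ _ _]].
move=> /and3P[_ V2 /and5P[/eqP Ex2 /eqP Ey2 _ _ _]] Ea; congr (_, _).
by apply: valid_equal => //; rewrite -?Ex1 -?Ey1.
Qed.

Definition arc_config (c : {ffun T -> 'I_N}) (j : {ffun T -> 'I_s}) (p : T * T) : config :=
  let walk u := Tuple (introT eqP (size_traject (parent c j) (parent c j u) k.+1)) in
  (p.1, p.2, walk p.1, walk p.2).

Definition root_pair c j (p : T * T) := (root c j p.1, root c j p.2).

Lemma arc_configP c j p : p \in full_arcs c j ->
  valid (arc_config c j p) /\ realised c j (arc_config c j p).
Proof.
case: p => u v; rewrite inE => /and4P[/= uW vL /andP[uA /eqP lu] /andP[vA /eqP lv]].
have ends w : w \in assigned c j -> level c w = k.+1 ->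
    (group (penult w (traject (parent c j) (parent c j w) k.+1))
       (last w (traject (parent c j) (parent c j w) k.+1)) ==
     c (last w (traject (parent c j) (parent c j w) k.+1))) /\
    block w (parent c j w) == j w.
  move=> wA lw; have w0 : 0 < level c w by rewrite lw.
  have [_ _ bl] := parentP wA w0; split; last exact/eqP/bl.
  have kw : k <= level c w by rewrite lw.
  have [iA li] := iter_parent wA kw.
  have l1 : level c (iter k (parent c j) w) = 1 by rewrite li lw subSnn.
  have [_ + _] := parentP iA (eq_leq (esym l1)).
  rewrite l1 => en; by rewrite last_traject /penult -trajectS nth_traject.
have [gu bu] := ends u uA lu; have [gv bv] := ends v vA lv.
split.
  rewrite /valid /arc_config; apply/and5P; split=> //; last apply/andP; last split.
  - by have := @path_parent c j u k.+1 uA; rewrite lu; apply.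
  - by have := @path_parent c j v k.+1 vA; rewrite lv; apply.
  - by have := @nonbacktracking_parent c j v u k.+1 uA; rewrite lu lv; apply.
  - by have := @nonbacktracking_parent c j u v k.+1 vA; rewrite lu lv; apply.
by rewrite /realised /arc_config; apply/and4P.
Qed.

Lemma last_walk c j u : full c j u ->
  last u (traject (parent c j) (parent c j u) k.+1) = root c j u.
Proof. by case/andP => _ /eqP lu; rewrite last_traject /root /forest_cell lu. Qed.

Lemma root_pair_apart c j p : p \in full_arcs c j -> root c j p.1 != root c j p.2.
Proof.
move=> pM; have [V _] := arc_configP pM.
have : last p.1 (traject (parent c j) (parent c j p.1) k.+1) !=
    last p.2 (traject (parent c j) (parent c j p.2) k.+1) := valid_ends V.
by move: pM; rewrite inE => /and4P[_ _ f1 f2]; rewrite !last_walk.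
Qed.

Lemma collisions_leq c j :
  #|[set pp : (T * T) * (T * T) | [&& pp.1 \in full_arcs c j, pp.2 \in full_arcs c j,
      pp.1 != pp.2 & root_pair c j pp.1 == root_pair c j pp.2]]| <=
  #|[set PP : config * config | [&& valid PP.1, valid PP.2 & compatible PP.1 PP.2] &&
      (realised c j PP.1 && realised c j PP.2)]|.
Proof.
pose F (pp : (T * T) * (T * T)) := (arc_config c j pp.1, arc_config c j pp.2).
have inF : injective F.
  move=> [[a b] [a' b']] [[x y] [x' y']].
  by move/(congr1 (fun Q : config * config => (Q.1.1.1, Q.2.1.1))).
rewrite -(card_imset _ inF); apply: subset_leq_card.
apply/subsetP => _ /imsetP[[p p'] + ->]; rewrite inE => /and4P[/= pM pM' npp /eqP[E1 E2]].
have [V R] := arc_configP pM; have [V' R'] := arc_configP pM'.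
rewrite inE [(F _).1]/= [(F _).2]/= V V' R R' /= andbT.
move: pM pM'; rewrite !inE => /and4P[_ _ f1 f2] /and4P[_ _ f1' f2'].
move: R R' => /and4P[/eqP g1 /eqP g2 _ _] /and4P[/eqP g1' /eqP g2' _ _].
have e1 := last_walk f1; have e2 := last_walk f2.
have e1' := last_walk f1'; have e2' := last_walk f2'.
have l1 := etrans e1 (etrans E1 (esym e1')); have l2 := etrans e2 (etrans E2 (esym e2')).
apply/and5P; split.
- exact/eqP/l1.
- exact/eqP/l2.
- by apply/eqP; apply: etrans g1 (etrans _ (esym g1')); congr (c _ : nat); apply: l1.
- by apply/eqP; apply: etrans g2 (etrans _ (esym g2')); congr (c _ : nat); apply: l2.
apply: contraNneq npp => /(congr1 (fun Q : config => Q.1.1)) /=.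
by rewrite -!surjective_pairing => ->.
Qed.

(** Both configurations end at the same two distinct hubs, which fixes two values of c, and start
    from four distinct vertices, which fixes four values of j. *)
Lemma card_realised (PP : config * config) :
  [&& valid PP.1, valid PP.2 & compatible PP.1 PP.2] ->
  #|[set cj : {ffun T -> 'I_N} * {ffun T -> 'I_s} |
      realised cj.1 cj.2 PP.1 && realised cj.1 cj.2 PP.2]| * (N ^ 2 * s ^ 4)
    <= N ^ #|T| * s ^ #|T|.
Proof.
case: PP => [[[[u v] p] q] [[[u' v'] p'] q']] /and3P[V V'].
move=> /and5P[/eqP Ex /eqP Ey _ _ neq].
have apart := valid_apart V V' Ex Ey neq; have xy := valid_ends V.
pose x := last u p; pose y := last v q.
pose gc z := if z == x then group (penult u p) x else group (penult v q) y.
pose gj z := if z == u then block u (head u p) else if z == v then block v (head v q)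
  else if z == u' then block u' (head u' p') else block v' (head v' q').
pose Dc := [set x; y]; pose Dj := [set z in [:: u; v; u'; v']].
have ne (a b : T) : a != b -> (b == a) = false by rewrite eq_sym => /negPf.
have cDc : #|Dc| = 2 by rewrite cards2 xy.
have cDj : #|Dj| = 4 by rewrite cardsE (card_uniqP apart).
have hc := card_ffun_fixed N Dc gc; have hj := card_ffun_fixed s Dj gj.
rewrite cDc in hc; rewrite cDj in hj.
apply: leq_trans (leq_mul hc hj).
rewrite mulnACA leq_mul2r; apply/orP; right; rewrite -cardsX; apply: subset_leq_card.
apply/subsetP => -[c j]; rewrite !inE /=.
move=> /andP[/and4P[g1 g2 b1 b2] /and4P[_ _ b1' b2']]; apply/andP; split.
  apply/forall_inP => z; rewrite !inE /gc => /orP[]/eqP->; first by rewrite eqxx.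
  by rewrite (ne _ _ xy).
move: apart; rewrite /= !inE !negb_or -!andbA.
move=> /and5P[n1 n2 n3 n4 /and3P[n5 n6 _]].
apply/forall_inP => z; rewrite !inE /gj => /or4P[]/eqP->; first by rewrite eqxx.
- by rewrite (ne _ _ n1) eqxx.
- by rewrite (ne _ _ n2) (ne _ _ n4) eqxx.
by rewrite (ne _ _ n3) (ne _ _ n5) (ne _ _ n6).
Qed.

Lemma sum_collisions :
  \sum_(cj : {ffun T -> 'I_N} * {ffun T -> 'I_s})
    #|[set pp : (T * T) * (T * T) | [&& pp.1 \in full_arcs cj.1 cj.2,
      pp.2 \in full_arcs cj.1 cj.2,
      pp.1 != pp.2 & root_pair cj.1 cj.2 pp.1 == root_pair cj.1 cj.2 pp.2]]|
  <= 512 * (#|W| * d) * (N ^ #|T| * s ^ #|T|).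
Proof.
have NS0 : 0 < N ^ 2 * s ^ 4 by rewrite muln_gt0 !expn_gt0 N_gt0 s_gt0.
rewrite -(leq_pmul2r NS0).
pose Cmp := [set PP : config * config | [&& valid PP.1, valid PP.2 & compatible PP.1 PP.2]].
apply: leq_trans (_ : (\sum_(PP in Cmp) #|[set cj : {ffun T -> 'I_N} * {ffun T -> 'I_s} |
      realised cj.1 cj.2 PP.1 && realised cj.1 cj.2 PP.2]|) * (N ^ 2 * s ^ 4) <= _).
  rewrite leq_mul2r; apply/orP; right.
  apply: leq_trans (_ : \sum_(cj : {ffun T -> 'I_N} * {ffun T -> 'I_s})
    #|[set PP | (PP \in Cmp) && (realised cj.1 cj.2 PP.1 && realised cj.1 cj.2 PP.2)]| <= _).
    apply: leq_sum => cj _; apply: leq_trans (collisions_leq cj.1 cj.2) _.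
    by apply: eq_leq; apply: eq_card => PP; rewrite !inE.
  under [leqLHS]eq_bigr do rewrite -sum1_card.
  rewrite (exchange_big_dep (mem Cmp)) /=; last by move=> cj PP _; rewrite in_set => /andP[].
  apply: leq_sum => PP PC; rewrite -sum1_card; apply: eq_leq; apply: eq_bigl => cj.
  by rewrite [in LHS]in_set PC [in RHS]in_set.
rewrite big_distrl /=.
apply: leq_trans (_ : \sum_(PP in Cmp) N ^ #|T| * s ^ #|T| <= _).
  by apply: leq_sum => PP; rewrite inE; apply: card_realised.
rewrite sum_nat_const mulnC [leqRHS]mulnAC [leqRHS]mulnC leq_mul2l; apply/orP; right.
apply: leq_trans card_compatible _; apply: eq_leq.
(* The constant is d^(2k+3) / (N^2 s^4) = (d / s^2)^3 = 8^3. *)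
rewrite /label_count !expnS !expn0 !muln1; move: (d ^ k) #|W| => X n.
rewrite /out_degree; clear; lia.
Qed.

(** * Every vertex is full with probability at least 3/4 *)

Lemma enters_path c v w p :
  path (fun x y => y \in L x) v (w :: p) ->
  (forall x, x \in belast w p -> x \notin hubs c) ->
  group (last v (belast v (w :: p))) (last w p) == c (last w p) ->
  enters c (size p) v w.
Proof.
elim: p v w => // w' p IHp v w /= /and3P[_ wL pp] hh gg; rewrite reachE hh ?mem_head //=.
apply/exists_inP; exists w' => //; apply: IHp => //=; first by rewrite wL.
by move=> x xp; apply: hh; rewrite inE xp orbT.
Qed.

Definition walks (u : T) (b : nat) : {set k.+1.-tuple T} :=
  [set p : k.+1.-tuple T | [&& path (fun x y => y \in L x) u p,
     nonbacktracking (u :: p) & block u (head u p) == b]].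

Definition alive (c : {ffun T -> 'I_N}) (u : T) (p : seq T) : bool :=
  group (penult u p) (last u p) == c (last u p).

Lemma full_intro c (j : {ffun T -> 'I_s}) u p : u \in W -> u \notin hubs c ->
  (forall i, i < k -> ~~ reach c i u) -> p \in walks u (j u) -> alive c u p ->
  (forall i, i < k -> nth u p i \notin hubs c) -> full c j u.
Proof.
move=> uW uh hr; case: p => -[|w p] //= sp; rewrite inE /= => /and3P[pp _ bl] al hh.
have sk : size p = k by apply/eqP.
have en : enters c k u w.
  rewrite -sk; apply: enters_path => //.
    move=> x /(nthP u)[i]; rewrite size_belast sk => ik <-.
    have := hh i ik; rewrite [w :: p]lastI nth_rcons size_belast sk ik //.
  move: al; rewrite /alive /penult /=.
  by rewrite [u :: w :: p]lastI nth_rcons size_belast /= sk ltnSn -[X in nth _ _ X]sk -(size_belast w) -[size _]/(size (u :: belast w p)).-1 nth_last.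
have wL : w \in L u by case/andP: pp.
have rk : reach c k u by rewrite reachE uh; apply/exists_inP; exists w.
have lk := level_intro (leqnn k) rk hr.
rewrite /full lk eqxx inE uW lk leqnn eqxx /= andbT.
by apply/exists_inP; exists w; rewrite // bl.
Qed.

Definition hub_labels (x : T) : nat := #|[set g : 'I_N | g * d < #|in_nbr x|]|.

Lemma card_hub x : x \in W ->
  #|[set c : {ffun T -> 'I_N} | x \in hubs c]| * N = hub_labels x * N ^ #|T|.
Proof.
move=> xW; have := card_ffun_constraints [set x] (fun x => [set g : 'I_N | g * d < #|in_nbr x|]).
rewrite cards1 expn1 big_set1 card_ord -/(hub_labels x) => <-; congr (_ * _).
apply: eq_card => c; rewrite !inE xW /=; apply/idP/forall_inP => [h y|h].
  by rewrite inE => /eqP->; rewrite inE.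
by have := h x (set11 x); rewrite inE.
Qed.

Hypothesis big_label : big * k.+1 <= N.

Lemma hub_labels_leq x : x \in W -> big * k.+1 * hub_labels x <= 2 * N.
Proof.
move=> xW; have hd : d * hub_labels x <= #|in_nbr x| + d by apply: card_multiples_lt d_gt0.
rewrite -(leq_pmul2r d_gt0).
apply: leq_trans (_ : big * k.+1 * (#|in_nbr x| + d) <= _).
  by rewrite -mulnA leq_mul2l [_ * d]mulnC hd orbT.
rewrite mulnDr mul2n -addnn mulnDl; apply: leq_add; first exact: in_nbr_bound.
by rewrite leq_mul2r big_label orbT.
Qed.

Lemma card_hub_leq x : x \in W ->
  big * k.+1 * #|[set c : {ffun T -> 'I_N} | x \in hubs c]| <= 2 * N ^ #|T|.
Proof.
move=> xW; rewrite -(leq_pmul2r N_gt0) -mulnA card_hub // mulnA [leqRHS]mulnAC.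
by rewrite leq_mul2r hub_labels_leq ?orbT.
Qed.

(** Union bound over the d^(i+1) walks, the last arc of each being selected with probability at most
    1/N. *)
Lemma card_reach i v : v \in W ->
  #|[set c : {ffun T -> 'I_N} | reach c i v]| * N <= d ^ i.+1 * N ^ #|T|.
Proof.
elim: i v => [|i IHi] v vW.
  apply: leq_trans (_ : #|[set c : {ffun T -> 'I_N} |
      [exists w, (w \in L v) && (group v w == c w)]]| * N <= _).
    rewrite leq_mul2r; apply/orP; right; apply: subset_leq_card; apply/subsetP => c.
    by rewrite !inE => /andP[].
  rewrite expn1 -(card_L vW); apply: card_exists_leq => w wL.
  have := card_ffun_fixed N [set w] (fun w => group v w); rewrite cards1 expn1.
  apply: leq_trans; rewrite leq_mul2r; apply/orP; right; apply: subset_leq_card.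
  apply/subsetP => c; rewrite !inE => h; apply/forall_inP => y.
  by rewrite inE => /eqP->.
apply: leq_trans (_ : #|[set c : {ffun T -> 'I_N} |
    [exists w, (w \in L v) && reach c i w]]| * N <= _).
  rewrite leq_mul2r; apply/orP; right; apply: subset_leq_card; apply/subsetP => c.
  by rewrite !inE => /andP[].
rewrite [d ^ i.+2]expnS -mulnA -[X in _ <= X * _](card_L vW); apply: card_exists_leq => w wL.
exact: IHi (L_W vW wL).
Qed.

Lemma sum_powers : \sum_(i < k) d ^ i.+1 <= 2 * d ^ k.
Proof.
have d2 : 2 <= d by rewrite /out_degree; move: s_gt0; clear; nia.
elim: (k) => [|n IHn]; first by rewrite big_ord0.
rewrite big_ord_recr /=; apply: leq_trans (leq_add IHn (leqnn _)) _.
rewrite [leqRHS]mul2n -addnn leq_add2r [leqRHS]expnS leq_mul2r d2 orbT //.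
Qed.

(** There are d + ... + d^k <= 2 d^k walks of length at most k, against N = s d^k. *)
Lemma card_early u : u \in W ->
  s * #|[set c : {ffun T -> 'I_N} | [exists i : 'I_k, reach c i u]]| <= 2 * N ^ #|T|.
Proof.
move=> uW; have dk0 : 0 < d ^ k by rewrite expn_gt0 d_gt0.
rewrite -(leq_pmul2r dk0) mulnAC -/label_count mulnC.
apply: leq_trans (_ : (\sum_(i < k) #|[set c : {ffun T -> 'I_N} | reach c i u]|) * N <= _).
  rewrite leq_mul2r; apply/orP; right; apply: leq_trans (card_bigcup_leq _ _).
  apply: subset_leq_card; apply/subsetP => x; rewrite inE => /existsP[i ri].
  by apply/bigcupP; exists i => //; rewrite inE.
rewrite big_distrl /=.
apply: leq_trans (_ : \sum_(i < k) d ^ i.+1 * N ^ #|T| <= _).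
  by apply: leq_sum => i _; apply: card_reach.
by rewrite -big_distrl /= mulnAC leq_mul2r sum_powers orbT.
Qed.

Lemma card_walks_leq u b : u \in W -> #|walks u b| <= 8 * s * d ^ k.
Proof.
move=> uW; pose B := [set w in L u | block u w == b].
have s8 : 0 < 8 * s by rewrite muln_gt0 s_gt0.
apply: leq_trans (_ : #|B| * d ^ k <= _); last first.
  by rewrite leq_mul2r card_chunk_leq ?orbT.
apply: (card_fibres_leq (f := fun p : k.+1.-tuple T => head u p)).
  by case=> -[|w p] //= sp; rewrite !inE /= => /and3P[/andP[-> _] _ ->].
move=> w; rewrite inE => /andP[wL _]; have wW := L_W uW wL.
have sub : #|[set p : k.-tuple T | path (fun x y => y \in L x) w p]| <= d ^ k.
  apply: (card_path_tuples (W := W)) => //; first exact: L_W.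
  by move=> x xW; rewrite cardsE -/(mem (L x)) (card_L xW).
apply: leq_trans sub; rewrite -(card_in_imset (f := fun p : k.+1.-tuple T => behead_tuple p)).
  apply: subset_leq_card; apply/subsetP => _ /imsetP[[[|w' p] //= sp] + ->].
  by rewrite !inE /= => /andP[/and3P[/andP[_ pp] _ _] /eqP <-].
move=> [[|a p] //= sp] [[|a' p'] //= sp']; rewrite !inE /= => /andP[_ /eqP Ea] /andP[_ /eqP Ea'].
by move/(congr1 val) => /= Ep; apply: val_inj; rewrite /= Ea Ea' Ep.
Qed.

Lemma card_walks_geq u b : u \in W -> b < s -> 8 * s * d.-1 ^ k <= #|walks u b|.
Proof.
move=> uW bs; pose B := [set w in L u | block u w == b].
have cB : 8 * s <= #|B|.
  apply: card_chunk_geq; rewrite card_L // /out_degree [leqRHS]mulnC.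
  by rewrite leq_mul2r bs orbT.
pose F := [set ap : T * k.-tuple T | (ap.1 \in B) &&
  (path (fun x y => y \in L x) ap.1 ap.2 && nonbacktracking (u :: ap.1 :: ap.2))].
have inf : injective (fun ap : T * k.-tuple T => cons_tuple ap.1 ap.2).
  by move=> [a p] [a' p'] /(congr1 val) /= [-> /val_inj ->].
apply: leq_trans (_ : #|F| <= _); last first.
  rewrite -(card_imset _ inf); apply: subset_leq_card.
  apply/subsetP => _ /imsetP[[a p] + ->].
  rewrite !inE [(a, p).1]/= [(a, p).2]/= => /andP[/andP[aL ab] /andP[pp np]].
  by apply/and3P; split=> //; apply/andP.
have -> : #|F| = \sum_(a in B)
    #|[set p : k.-tuple T | path (fun x y => y \in L x) a p && nonbacktracking (u :: a :: p)]|.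
  under eq_bigr do rewrite -sum1_card.
  by rewrite pair_big_dep /= -sum1_card; apply: eq_bigl => -[a p]; rewrite !inE.
apply: leq_trans (_ : \sum_(a in B) d.-1 ^ k <= _).
  by rewrite sum_nat_const leq_mul2r cB orbT.
apply: leq_sum => a; rewrite inE => /andP[aL _].
apply: (card_nonbacktracking_tuples (W := W)).
- exact: L_W.
- by move=> x xW; rewrite cardsE -/(mem (L x)) (card_L xW).
- exact: L_W aL.
Qed.

Lemma walks_uniq u b (p : k.+1.-tuple T) : u \in W -> p \in walks u b -> uniq (u :: p).
Proof.
move=> uW; rewrite inE => /and3P[pp np _]; apply/negPn/negP => nu.
have := nonbacktracking_cycle (s := u :: p) e_irr e_girth (path_L_e uW pp) np nu.
by rewrite /= size_tuple; clear; lia.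
Qed.

Lemma walks_last_inj u b : u \in W -> {in walks u b &, injective (fun p : k.+1.-tuple T => last u p)}.
Proof.
move=> uW p q; rewrite !inE => /and3P[pp np _] /and3P[pq nq _] E; apply: val_inj.
apply: (nonbacktracking_unique e_sym e_irr e_girth (path_L_e uW pp) (path_L_e uW pq)) => //.
by rewrite !size_tuple; clear; lia.
Qed.

Hypothesis d_large : 2 * k <= d.
Hypothesis N_gt1 : 1 < N.

(** A block offers 8s first steps, and forbidding backtracking costs a factor (1 - 1/d)^k >= 1/2
    because [2 * k <= d]. *)
Lemma card_walks_large u b : u \in W -> b < s -> 4 * N <= #|walks u b|.
Proof.
move=> uW bs; apply: leq_trans (card_walks_geq uW bs).
have : d ^ k <= 2 * d.-1 ^ k.
  have kd : k <= d by apply: leq_trans d_large; rewrite mul2n -addnn leq_addr.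
  rewrite -(leq_pmul2r d_gt0).
  apply: leq_trans (_ : d ^ k * (2 * (d - k)) <= _); last first.
    by rewrite mulnCA -mulnA leq_mul2l [_ ^ k * d]mulnC (expn_pred_bernoulli kd).
  by rewrite leq_mul2l; apply/orP; right; move: d_large; clear; lia.
by rewrite /label_count; move: (d ^ k) (d.-1 ^ k) => X Y; clear; nia.
Qed.

(** The walks end at distinct vertices by the girth, so their selections are independent events of
    probability 1/N. With at least 4N walks, all fail with probability at most (N-1)/(5N-1) <
    1/5. *)
Lemma card_no_alive u b : u \in W -> b < s ->
  5 * #|[set c : {ffun T -> 'I_N} | [forall p in walks u b, ~~ alive c u p]]| <= N ^ #|T|.
Proof.
move=> uW bs; pose E := [set last u (p : k.+1.-tuple T) | p in walks u b].
have cE : #|E| = #|walks u b| by apply: card_in_imset; apply: walks_last_inj.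
pose g x := if [pick p in walks u b | last u p == x] is Some p then group (penult u p) x else 0.
have gE p : p \in walks u b -> g (last u p) = group (penult u p) (last u p).
  move=> pw; rewrite /g; case: pickP => [q /andP[qw /eqP E1]|/(_ p)]; last by rewrite pw eqxx.
  by rewrite (walks_last_inj uW qw pw E1).
pose Q x := [set a : 'I_N | g x != a].
have cQ x : x \in E -> #|Q x| = N.-1.
  case/imsetP => p pw ->; have := pw; rewrite inE => /and3P[pp _ _].
  have [aW xL] := penult_L uW pp.
  have gN : g (last u p) < N by rewrite gE // group_lt.
  have -> : Q (last u p) = [set~ Ordinal gN].
    by apply/setP => a; rewrite !inE -val_eqE eq_sym.
  by rewrite cardsC1 card_ord.
set S := [set c | _].
have hS : #|S| * N ^ #|E| <= N.-1 ^ #|E| * N ^ #|T|.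
  have := card_ffun_constraints E Q; rewrite card_ord (eq_bigr _ cQ) prod_nat_const => <-.
  rewrite leq_mul2r; apply/orP; right; apply: subset_leq_card; apply/subsetP => c.
  rewrite !inE => /forall_inP h; apply/forall_inP => _ /imsetP[p pw ->]; rewrite inE gE //.
  exact: h.
have hE : 5 * N.-1 ^ #|E| <= N ^ #|E|.
  have N1 : 0 < N.-1 by rewrite -ltnS prednK // N_gt0.
  rewrite -(leq_pmul2r N1); apply: leq_trans (expn_pred_upper #|E| N_gt0).
  rewrite mulnAC mulnC leq_mul2l; apply/orP; right.
  by have := card_walks_large uW bs; rewrite -cE; move: N N_gt0 #|E|; clear; lia.
have NE : 0 < N ^ #|E| by rewrite expn_gt0 N_gt0.
rewrite -(leq_pmul2r NE) -mulnA; apply: leq_trans (leq_mul (leqnn 5) hS) _.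
by rewrite mulnA mulnC leq_mul2l hE orbT.
Qed.

(** There are at most 8Nk choices of a walk and an interior vertex. The walk has no repeated vertex,
    so its selection (probability 1/N) is independent of the interior vertex being a hub (at most
    2/([big * k.+1])). *)
Lemma card_alive_through_hub u b : u \in W ->
  big * #|[set c : {ffun T -> 'I_N} | [exists p in walks u b,
     alive c u p && [exists i : 'I_k, nth u p i \in hubs c]]]| <= 16 * N ^ #|T|.
Proof.
move=> uW.
pose A := [pred pi : k.+1.-tuple T * 'I_k | pi.1 \in walks u b].
pose P (pi : k.+1.-tuple T * 'I_k) := [pred c : {ffun T -> 'I_N} |
  alive c u pi.1 && (nth u pi.1 pi.2 \in hubs c)].
set S := [set c | _].
have SE : S = [set c | [exists pi, A pi && P pi c]].
  apply/setP => c; rewrite !inE; apply/exists_inP/existsP => [[p pw /andP[al /existsP[i h]]]|].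
    by exists (p, i); rewrite /= pw al.
  by move=> [[p i] /= /andP[pw /andP[al h]]]; exists p => //; rewrite al; apply/existsP; exists i.
have hP pi : A pi -> #|[set c | P pi c]| * (big * k.+1 * N) <= 2 * N ^ #|T|.
  case: pi => p i /= pw; pose x := nth u p i; pose y := last u p.
  have := pw; rewrite inE => /and3P[pp _ _].
  have sp : size p = k.+1 by rewrite size_tuple.
  have ip : i < size p by rewrite sp ltnS ltnW.
  have xy : x != y.
    have /= /andP[_ up] := walks_uniq uW pw.
    rewrite /x /y -nth_last sp /= nth_uniq ?sp //; last by rewrite ltnS ltnW.
    by rewrite neq_ltn ltn_ord.
  have xW : x \in W.
    have -> : x = last u (take i.+1 p).
      by rewrite (take_nth u) // last_rcons.
    apply: path_L_W => //; move: pp; rewrite -{1}(cat_take_drop i.+1 p) cat_path.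
    by case/andP.
  pose Q z := if z == x then [set g : 'I_N | g * d < #|in_nbr x|]
    else [set g : 'I_N | group (penult u p) y == g].
  have := card_ffun_constraints [set x; y] Q.
  rewrite cards2 xy /= card_ord big_setU1 ?inE //= big_set1 /Q eqxx.
  rewrite [y == x]eq_sym (negPf xy) -/(hub_labels x) => EQ.
  have sub : #|[set c | P (p, i) c]| * N ^ 2 <= hub_labels x * N ^ #|T|.
    apply: leq_trans (_ : hub_labels x * #|[set g : 'I_N | group (penult u p) y == g]| * N ^ #|T| <= _).
      rewrite -EQ leq_mul2r; apply/orP; right; apply: subset_leq_card; apply/subsetP => c.
      rewrite !inE /= => /and3P[al _ h]; apply/forall_inP => z; rewrite !inE.
      case: eqP => [-> _|_ /eqP->]; last by rewrite inE.
      by rewrite inE.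
    rewrite leq_mul2r; apply/orP; right; rewrite -[leqRHS]muln1 leq_mul2l; apply/orP; right.
    by apply/card_le1_eqP => a a'; rewrite !inE => /eqP ga /eqP ga'; apply: val_inj; rewrite /= -ga -ga'.
  rewrite -(leq_pmul2r N_gt0).
  apply: leq_trans (_ : big * k.+1 * (hub_labels x * N ^ #|T|) <= _).
    apply: leq_trans (leq_mul (leqnn (big * k.+1)) sub); apply: eq_leq.
    by rewrite -mulnn; move: (big * k.+1) N #|_|; clear; lia.
  by rewrite mulnA [leqRHS]mulnAC leq_mul2r hub_labels_leq ?orbT.
have k0 : 0 < k.+1 * N by rewrite muln_gt0 N_gt0.
rewrite -(leq_pmul2r k0); have := card_exists_leq hP; rewrite -SE => h.
apply: leq_trans (_ : #|S| * (big * k.+1 * N) <= _).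
  by apply: eq_leq; move: big N #|S|; clear; lia.
apply: leq_trans h _.
have cA : #|A| <= 8 * N * k.
  have -> : #|A| = #|setX (walks u b) [set: 'I_k]|.
    by apply: eq_card => -[p i]; rewrite !inE andbT.
  rewrite cardsX cardsT card_ord leq_mul2r; apply/orP; right.
  by rewrite /label_count mulnA card_walks_leq.
apply: leq_trans (leq_mul cA (leqnn _)) _.
by move: N (N ^ #|T|) => n m; clear; nia.
Qed.

Hypothesis big_s : big <= s.

(* The vertex u can only fail to be full if it is a hub, if it is too close to a
   hub, if no walk through its block is selected, or if some selected walk passes
   through another hub. *)
Lemma card_not_full_labels j u : 400 <= big -> u \in W ->
  4 * #|[set c : {ffun T -> 'I_N} | ~~ full c j u]| <= N ^ #|T|.
Proof.
move=> big400 uW; set X := N ^ #|T|.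
pose S0 := [set c : {ffun T -> 'I_N} | u \in hubs c].
pose S1 := [set c : {ffun T -> 'I_N} | [exists i : 'I_k, reach c i u]].
pose S2 := [set c : {ffun T -> 'I_N} | [forall p in walks u (j u), ~~ alive c u p]].
pose S3 := [set c : {ffun T -> 'I_N} | [exists p in walks u (j u),
     alive c u p && [exists i : 'I_k, nth u p i \in hubs c]]].
have sub : [set c : {ffun T -> 'I_N} | ~~ full c j u] \subset S0 :|: S1 :|: (S2 :|: S3).
  apply/subsetP => c; rewrite inE; apply: contraR; rewrite !in_setU !negb_or.
  case/andP => /andP[]; rewrite ![c \in _]inE => h0 h1 /andP[h2 h3].
  move: h2; rewrite negb_forall => /existsP[p]; rewrite negb_imply negbK => /andP[pw al].
  apply: (full_intro (p := p)) => //.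
    move=> i ik; move: h1; rewrite negb_exists => /forallP/(_ (Ordinal ik)).
    by [].
  move=> i ik; apply: contra h3 => h; apply/exists_inP; exists p => //; rewrite al.
  by apply/existsP; exists (Ordinal ik).
have H0 : big * #|S0| <= 2 * X.
  apply: leq_trans (card_hub_leq uW); rewrite leq_mul2r; apply/orP; right.
  exact: leq_pmulr.
have H1 : big * #|S1| <= 2 * X.
  by apply: leq_trans (card_early uW); rewrite leq_mul2r big_s orbT.
have H2 : 5 * #|S2| <= X by apply: card_no_alive.
have H3 : big * #|S3| <= 16 * X by apply: card_alive_through_hub.
have H : #|[set c : {ffun T -> 'I_N} | ~~ full c j u]| <= #|S0| + #|S1| + (#|S2| + #|S3|).
  apply: leq_trans (subset_leq_card sub) _; apply: leq_trans (leq_card_setU _ _) _.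
  by apply: leq_add; exact: leq_card_setU.
move: H H0 H1 H2 H3 big400; move: #|_| #|S0| #|S1| #|S2| #|S3| X => f a0 a1 a2 a3 X.
clear; move=> H H0 H1 H2 H3 h.
(* The failure probabilities add up to 1/5 + (2 + 2 + 16)/[big], which is at most 1/4 once [big] is
   at least 400. *)
have b0 : 0 < 5 * big by lia.
rewrite -(leq_pmul2l b0).
have : 5 * big * f <= 100 * X + big * X by nia.
have : 400 * X <= big * X by rewrite leq_mul2r h orbT.
by lia.
Qed.

(** * Averaging over all labellings *)

Definition outcomes : nat := N ^ #|T| * s ^ #|T|.

Lemma card_labels : #|{: {ffun T -> 'I_N} * {ffun T -> 'I_s}}| = outcomes.
Proof. by rewrite card_prod !card_ffun !card_ord. Qed.

Lemma card_not_full u : 400 <= big -> u \in W ->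
  4 * #|[set cj : {ffun T -> 'I_N} * {ffun T -> 'I_s} | ~~ full cj.1 cj.2 u]| <= outcomes.
Proof.
move=> big400 uW.
have -> : #|[set cj : {ffun T -> 'I_N} * {ffun T -> 'I_s} | ~~ full cj.1 cj.2 u]| =
    \sum_(j : {ffun T -> 'I_s}) #|[set c : {ffun T -> 'I_N} | ~~ full c j u]|.
  under [RHS]eq_bigr do rewrite -sum1_card big_mkcond.
  rewrite exchange_big pair_bigA -sum1_card [LHS]big_mkcond /=.
  by apply: eq_bigr => -[c j] _; rewrite !inE.
rewrite big_distrr /= /outcomes mulnC -[s in s ^ _]card_ord -card_ffun -sum_nat_const.
by apply: leq_sum => j _; apply: card_not_full_labels.
Qed.

Lemma sum_full_arcs : 400 <= big ->
  #|W| * d * outcomes <= 2 * \sum_(cj : {ffun T -> 'I_N} * {ffun T -> 'I_s})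
    #|full_arcs cj.1 cj.2|.
Proof.
move=> big400; have -> : \sum_(cj : {ffun T -> 'I_N} * {ffun T -> 'I_s}) #|full_arcs cj.1 cj.2| =
    \sum_(p in out_arcs) #|[set cj : {ffun T -> 'I_N} * {ffun T -> 'I_s} |
      full cj.1 cj.2 p.1 && full cj.1 cj.2 p.2]|.
  under [LHS]eq_bigr do rewrite -sum1_card.
  rewrite (exchange_big_dep (mem out_arcs)) /=; last first.
    by move=> cj p _; rewrite !inE => /and3P[-> ->].
  apply: eq_bigr => p pE; rewrite -sum1_card; apply: eq_bigl => cj.
  by move: pE; rewrite !inE => /andP[-> ->].
rewrite -card_out_arcs -sum_nat_const big_distrr /=; apply: leq_sum => p.
rewrite inE => /andP[p1 pL]; have p2 := L_W p1 pL.
have h1 := card_not_full big400 p1; have h2 := card_not_full big400 p2.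
move: h1 h2; set S1 := [set cj | _]; set S2 := [set cj | _]; set S := [set cj | _] => h1 h2.
have : outcomes <= #|S| + (#|S1| + #|S2|).
  rewrite -card_labels -cardsT.
  apply: leq_trans (_ : #|S :|: (S1 :|: S2)| <= _).
    apply: subset_leq_card; apply/subsetP => cj _; rewrite !inE.
    by case: (full _ _ p.1); case: (full _ _ p.2).
  apply: leq_trans (leq_card_setU _ _) _; rewrite leq_add2l; exact: leq_card_setU.
by move: h1 h2; move: #|S| #|S1| #|S2| outcomes; clear; lia.
Qed.

Lemma sum_in_nbr : \sum_(x in W) #|in_nbr x| = #|W| * d.
Proof.
rewrite -sum_nat_const -(eq_bigr _ (fun v vW => card_L vW)).
under eq_bigr do rewrite -sum1_card.
rewrite (exchange_big_dep (mem W)) /=; last by move=> x v _; rewrite inE => /andP[].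
apply: eq_bigr => v vW; rewrite -sum1_card; apply: eq_bigl => x; rewrite inE vW /=.
by apply: andb_idl; apply: L_W.
Qed.

(** At most [#|in_nbr x|]/d + 1 labels make x a hub, and the in-degrees average d, so the expected
    density of hubs is at most 2/N. *)
Lemma sum_hubs :
  N * (\sum_(cj : {ffun T -> 'I_N} * {ffun T -> 'I_s}) #|hubs cj.1|) <= 2 * #|W| * outcomes.
Proof.
rewrite -(pair_bigA _ (fun (c : {ffun T -> 'I_N}) (j : {ffun T -> 'I_s}) => #|hubs c|)) /=.
rewrite exchange_big /= sum_nat_const card_ffun card_ord mulnCA /outcomes.
rewrite [_ * s ^ _]mulnC [leqRHS]mulnCA leq_mul2l; apply/orP; right.
have -> : \sum_(c : {ffun T -> 'I_N}) #|hubs c| =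
    \sum_(x in W) #|[set c : {ffun T -> 'I_N} | x \in hubs c]|.
  under [LHS]eq_bigr do rewrite -sum1_card.
  rewrite (exchange_big_dep (mem W)) /=; last by move=> c x _; rewrite inE => /andP[].
  by apply: eq_bigr => x xW; rewrite -sum1_card; apply: eq_bigl => c; rewrite [in RHS]inE.
rewrite mulnC big_distrl /= (eq_bigr _ (fun x xW => card_hub xW)) -big_distrl /=.
rewrite leq_mul2r; apply/orP; right; rewrite -(leq_pmul2l d_gt0) big_distrr /=.
apply: leq_trans (_ : \sum_(x in W) (#|in_nbr x| + d) <= _).
  by apply: leq_sum => x _; apply: card_multiples_lt d_gt0.
by rewrite big_split /= sum_in_nbr sum_nat_const; move: #|W| d; clear; lia.
Qed.

Lemma random_forest K : 400 <= big -> 1025 <= K -> W != set0 ->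
  exists (W' : {set T}) (e' : rel T), [/\ symmetric e', irreflexive e', gmodel W e W' e',
    W' != set0 & N * d * #|W'| <= 8 * K * arcs e' W'].
Proof.
move=> big400 hK W0.
pose Q (cj : {ffun T -> 'I_N} * {ffun T -> 'I_s}) :=
  arcs (forest_adj e (assigned cj.1 cj.2) (root cj.1 cj.2)) (hubs cj.1).
have hQ cj : #|root_pair cj.1 cj.2 @: full_arcs cj.1 cj.2| <= Q cj.
  case: cj => c j /=; rewrite /Q /= -pairs_arcs; apply: subset_leq_card.
  apply/subsetP => _ /imsetP[[u v] uvM ->]; have /= apart := root_pair_apart uvM.
  have /and4P[/= uW vL fu fv] : [&& (u, v).1 \in W, (u, v).2 \in L (u, v).1,
    full c j (u, v).1 & full c j (u, v).2] by move: uvM; rewrite inE.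
  have rh w : full c j w -> root c j w \in hubs c.
    case/andP=> wA /eqP lw; have [] := iter_parent (i := level c w) wA (leqnn _).
    by rewrite subnn => _ /eqP; rewrite level_eq0.
  rewrite inE /= !rh //= /forest_adj apart /=.
  have uA : u \in assigned c j by case/andP: fu.
  have vA : v \in assigned c j by case/andP: fv.
  apply/exists_inP; exists u => //; apply/exists_inP; exists v => //.
  by rewrite !eqxx L_adj.
pose n := #|W| * d * outcomes.
have o0 : 0 < outcomes by rewrite /outcomes muln_gt0 !expn_gt0 N_gt0 s_gt0.
have Wd0 : 0 < #|W| * d by rewrite muln_gt0 card_gt0 W0 d_gt0.
(* With a and q the sums of the numbers of full arcs and of [Q], summing [collision_count] gives (2K
   - 1) a <= K^2 q + 512 n. As a >= n/2, the condition K >= 1025 is what turns this into n <=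
   2Kq. *)
have main : n <= 2 * K * \sum_cj Q cj.
  have hA := sum_full_arcs big400; have hC := sum_collisions.
  rewrite -/outcomes -/n in hA hC; rewrite -mulnA -/n in hC.
  have h : 2 * K * (\sum_(cj : {ffun T -> 'I_N} * {ffun T -> 'I_s}) #|full_arcs cj.1 cj.2|)
      <= K ^ 2 * (\sum_cj Q cj) +
         (\sum_(cj : {ffun T -> 'I_N} * {ffun T -> 'I_s}) #|full_arcs cj.1 cj.2|) + 512 * n.
    apply: leq_trans (leq_add (leqnn _) hC); rewrite !big_distrr -!big_split /=.
    apply: leq_sum => cj _.
    apply: leq_trans (collision_count (full_arcs cj.1 cj.2) (root_pair cj.1 cj.2) K) _.
    by rewrite !leq_add2r leq_mul2l hQ orbT.
  move: hK hA h; clear hC; rewrite -mulnn; move: n (\sum_cj _) (\sum_cj Q cj) => m a q.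
  clear; move=> hK hA h; have : (2 * K).-1 * m <= 2 * K * K * q + 1024 * m by nia.
  by nia.
have n0 : 0 < n by rewrite /n muln_gt0 Wd0 o0.
(* If every labelling failed, summation would give 8Kq <= Nd (sum of hub counts) <= 2n <= 4Kq,
   contradicting n > 0. A labelling without hubs has [Q cj] = 0 and so satisfies the reversed
   inequality. *)
have [[cj /andP[h0 hcj]]|hno] :
    (exists cj, (hubs cj.1 != set0) && (N * d * #|hubs cj.1| <= 8 * K * Q cj)) \/
    (forall cj, 8 * K * Q cj <= N * d * #|hubs cj.1|).
- have [/existsP|] := boolP [exists cj, (hubs cj.1 != set0) && (N * d * #|hubs cj.1| <= 8 * K * Q cj)].
    by left.
  rewrite negb_exists => /forallP h; right => cj; have := h cj; rewrite negb_and negbK.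
  case/orP => [/eqP E|]; last by rewrite -ltnNge => /ltnW.
  by rewrite /Q E /arcs big_set0 muln0.
- exists (hubs cj.1), (forest_adj e (assigned cj.1 cj.2) (root cj.1 cj.2)); split=> //.
  + exact: forest_adj_sym.
  + by move=> x; rewrite /forest_adj eqxx.
  + exact: hubs_gmodel.
exfalso.
have : 8 * K * (\sum_cj Q cj) <= N * d * \sum_(cj : {ffun T -> 'I_N} * {ffun T -> 'I_s}) #|hubs cj.1|.
  by rewrite !big_distrr /=; apply: leq_sum => cj _; apply: hno.
have := leq_mul (leqnn d) sum_hubs; rewrite mulnA [d * N]mulnC.
have -> : d * (2 * #|W| * outcomes) = 2 * n by rewrite /n; move: #|W| d outcomes; clear; lia.
move: main n0 hK; move: (\sum_cj Q cj) (N * d * _) n; clear; nia.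
Qed.

End RandomForest.

(** * Colouring *)

(** Were all degrees at least 4d, a subgraph with degrees between d and [48 * D] would exist. The
    first numerical bound on D is then the in-degree hypothesis of the random forest; the second
    makes the resulting minor too dense, as 16K = 8K * 2. *)
Lemma low_degree_vertex (T : finType) (e : rel T) (W : {set T}) (k s D big K : nat) :
  symmetric e -> irreflexive e -> girth_ge e (4 * k.+1 + 1) -> W != set0 ->
  400 <= big -> 1025 <= K -> big * k.+1 <= s ->
  big * k.+1 * (48 * D) <= s * out_degree s ^ k.+1 ->
  16 * K * D <= s * out_degree s ^ k.+1 ->
  (forall (W' : {set T}) (e' : rel T), symmetric e' -> irreflexive e' ->
     gmodel W e W' e' -> W' != set0 -> arcs e' W' < 2 * D * #|W'|) ->
  exists2 x, x \in W & #|nbr e W x| < 4 * out_degree s.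
Proof.
move=> se ie hg W0 big400 hK hs hD1 hD2 hD.
have [/exists_inP//|/exists_inPn hdeg] := boolP [exists x in W, #|nbr e W x| < 4 * out_degree s].
exfalso; set d := out_degree s in hD1 hD2 hdeg.
have b0 : 0 < big by apply: leq_trans big400.
have bs : big <= s by apply: leq_trans hs; apply: leq_pmulr.
have s400 : 400 <= s by apply: leq_trans bs.
have s0 : 0 < s by apply: leq_trans bs.
have ks : k <= s by apply: leq_trans hs; apply: ltnW; apply: leq_pmull.
have sd : s <= d by rewrite /d /out_degree; move: s0; clear; nia.
have d2 : 2 <= d by apply: leq_trans sd; apply: leq_trans s400.
have kd : 2 * k <= d by move: ks s0; rewrite /d /out_degree; clear; nia.
have hg5 : girth_ge e 5.
  by move=> c sc cc uc; apply: leq_trans (hg c sc cc uc); clear; lia.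
have [|e0 [W1 [se0 sub0 sW1 W10 hW1]]] := bounded_degree_subgraph se ie hg5 W0 d2 _ hD.
  by move=> x xW; rewrite leqNgt hdeg.
have ie0 : irreflexive e0 by move=> x; apply/negP => /sub0; rewrite ie.
have g1 : gmodel W e W1 e0 by apply: gmodel_sub => // x y _ _; apply: sub0.
pose L v := pick_subset d (nbr e0 W1 v).
have LN v : v \in W1 -> L v \subset nbr e0 W1 v by move=> _; apply: pick_subset_sub.
have cL v : v \in W1 -> #|L v| = d.
  by move=> vW; apply: card_pick_subset; case/andP: (hW1 v vW).
have sN : s <= label_count k s.
  by apply: leq_pmulr; rewrite expn_gt0 (leq_trans _ d2).
have Nd : label_count k s * d = s * d ^ k.+1.
  by rewrite /label_count -/d expnSr mulnA.
have hin x : x \in W1 -> big * k.+1 * #|in_nbr W1 L x| <= label_count k s * out_degree s.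
  move=> xW; rewrite -/d Nd; apply: leq_trans hD1; rewrite leq_mul2l; apply/orP; right.
  apply: leq_trans (_ : #|nbr e0 W1 x| <= _); last by case/andP: (hW1 x xW).
  apply: subset_leq_card; apply/subsetP => v; rewrite inE => /andP[vW /(subsetP (LN v vW))].
  by rewrite !nbrP vW se0 => /andP[].
have hl : big * k.+1 <= label_count k s := leq_trans hs sN.
have N1 : 1 < label_count k s by apply: leq_trans sN; apply: leq_trans s400.
have [W' [e' [se' ie' g' W'0 hW']]] := random_forest se0 ie0
  (girth_ge_sub sub0 hg) b0 s0 LN cL hin hl kd N1 bs big400 hK W10.
have := hD W' e' se' ie' (gmodel_trans se g1 g') W'0.
apply/negP; rewrite -leqNgt -/d Nd in hW' *.
have K0 : 0 < 8 * K by rewrite muln_gt0 /=; apply: leq_trans hK.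
rewrite -(leq_pmul2l K0); apply: leq_trans hW'; rewrite mulnA leq_mul2r; apply/orP; right.
by apply: leq_trans hD2; clear; lia.
Qed.

Lemma degenerate_colourable (G : sgraph) (R : nat) : 0 < R ->
  (forall W : {set G}, W != set0 -> exists2 x, x \in W & #|nbr (@adj G) W x| < R) ->
  colourable G R.
Proof.
case: R => // R _ hdeg.
suff: forall W : {set G}, exists f : {ffun G -> 'I_R.+1},
    {in W &, forall x y, adj x y -> f x != f y}.
  case/(_ setT) => f hf; apply/existsP; exists f; apply/forallP => x; apply/forallP => y.
  by apply/implyP => /hf; apply; rewrite inE.
move=> W; have [n] := ubnP #|W|; elim: n W => // n IHn W Wn.
have [->|W0] := eqVneq W set0.
  by exists [ffun=> ord0] => x y; rewrite inE.
have [x xW dx] := hdeg W W0.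
have [|f hf] := IHn (W :\ x); first by move: Wn; rewrite (cardsD1 x W) xW.
have /card_gt0P[a] : 0 < #|~: (f @: nbr (@adj G) W x)|.
  rewrite -(ltn_add2l #|f @: nbr (@adj G) W x|) cardsC card_ord addn0.
  exact: leq_ltn_trans (leq_imset_card _ _) dx.
rewrite inE => /imsetP ha.
exists [ffun y => if y == x then a else f y] => y z yW zW yz; rewrite !ffunE.
have [Ey|ny] := eqVneq y x; have [Ez|nz] := eqVneq z x.
- by rewrite Ey Ez adj_irrefl in yz.
- by apply/eqP => E; apply: ha; exists z; rewrite // nbrP zW -Ey.
- by apply/eqP => E; apply: ha; exists y; rewrite // nbrP yW adj_sym -Ez.
by apply: hf => //; rewrite !inE ?ny ?nz.
Qed.

Lemma chromatic_number_leq (G : sgraph) (k s D t h big K : nat) :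
  minor_free (complete_graph t) G -> girth_at_least G (4 * k.+1 + 1) -> 0 < t ->
  0 < h -> 2 * t * 8 ^ h * 3 ^ (h ^ 2) <= 4 ^ (h ^ 2) -> 28 * h * t <= D ->
  400 <= big -> 1025 <= K -> big * k.+1 <= s ->
  big * k.+1 * (48 * D) <= s * out_degree s ^ k.+1 ->
  16 * K * D <= s * out_degree s ^ k.+1 ->
  chromatic_number G <= 4 * out_degree s.
Proof.
move=> Gt Gg t0 h0 ht hD big400 hK hs hD1 hD2.
have s0 : 0 < s.
  apply: leq_trans hs; rewrite muln_gt0 andbT; exact: leq_trans big400.
rewrite /chromatic_number; case: ex_minnP => m _; apply; apply: degenerate_colourable.
  by rewrite /out_degree !muln_gt0 s0.
move=> W W0; apply: (low_degree_vertex (D := D) (k := k) (big := big) (K := K)) => //.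
- exact: adj_sym.
- exact: adj_irrefl.
- exact: girth_ge_adj.
move=> W' e' se' ie' g W'0; rewrite ltnNge; apply/negP => hW'; apply: Gt.
apply: gmodel_minor.
have gW : gmodel [set: G] (@adj G) W (@adj G) by apply: gmodel_sub.
apply: (gmodel_trans (@adj_sym G) (gmodel_trans (@adj_sym G) gW g)).
exact: (dense_clique se' ie' W'0 hW' h0 t0 hD ht).
Qed.

(** As 4 * 3^5 = 972 <= 4^5, the ratio (4/3)^(400 m^2) is at least 4^(80 m^2) = 2^(160 m^2), which
    absorbs 2 * 2^(m^2) * 2^(60m). *)
Lemma undominated_exponent (t m : nat) : 0 < m -> t <= 2 ^ (m ^ 2) ->
  2 * t * 8 ^ (20 * m) * 3 ^ ((20 * m) ^ 2) <= 4 ^ ((20 * m) ^ 2).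
Proof.
move=> m0 ht; set n := m ^ 2 in ht *.
have mn : m <= n by rewrite /n -mulnn leq_pmulr.
have -> : (20 * m) ^ 2 = 5 * (80 * n) by rewrite expnMn -/n; clear; lia.
rewrite [leqRHS]expnM; apply: leq_trans (_ : (4 * 3 ^ 5) ^ (80 * n) <= _); last first.
  by rewrite leq_exp2r //; move: mn m0; clear; lia.
rewrite expnMn -expnM leq_mul2r; apply/orP; right.
apply: leq_trans (_ : 2 * 2 ^ n * 8 ^ (20 * m) <= _).
  by rewrite leq_mul2r leq_mul2l ht !orbT.
rewrite -[8]/(2 ^ 3) -[4]/(2 ^ 2) -!expnM -expnS -expnD leq_exp2l //.
by move: mn m0; clear; lia.
Qed.

(** The integer form of the bound, free of roots and logarithms: m stands for sqrt(log t) and s for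
    the root of order 2k+3 of m t, up to constants. *)
Lemma chromatic_number_powers (k : nat) : exists2 c : nat, 0 < c &
  forall (G : sgraph) (t m s : nat),
  minor_free (complete_graph t) G -> girth_at_least G (4 * k.+1 + 1) -> 0 < t ->
  0 < m -> t <= 2 ^ (m ^ 2) -> c <= s -> c * m * t <= s ^ (2 * k.+1 + 1) ->
  chromatic_number G <= 32 * s ^ 2.
Proof.
(* Hidden behind variables, as conversion would unfold the numerals. *)
have [big hbig] : exists b, 400 <= b by exists 400.
have [K hK] : exists b, 1025 <= b by exists 1025.
have [q hq] : exists b, 48 * 560 + 16 * 560 <= b by exists (48 * 560 + 16 * 560).
have q0 : 0 < q by move: hq; clear; lia.
have b0 : 0 < big by move: hbig; clear; lia.
have K0 : 0 < K by move: hK; clear; lia.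
have c0 : 0 < q * big * K * k.+1 by rewrite !muln_gt0 q0 b0 K0.
exists (q * big * K * k.+1) => [|G t m s Gt Gg t0 m0 ht cs hs].
  exact: c0.
have bk : big * k.+1 <= q * big * K * k.+1 by rewrite leq_mul2r mulnAC leq_pmull ?orbT // muln_gt0 q0.
have s0 : 0 < s := leq_trans c0 cs.
have hpow : s ^ (2 * k.+1 + 1) <= s * out_degree s ^ k.+1.
  rewrite addn1 expnS leq_mul2l; apply/orP; right; rewrite expnM leq_exp2r //.
  by rewrite /out_degree -mulnn -mulnA leq_pmull.
(* 560 = 28 * 20, for branch sets grown from h = [20 * m] random vertices. *)
have [D hD] : exists D, D = 560 * (m * t) by eexists.
have -> : 32 * s ^ 2 = 4 * out_degree s by rewrite /out_degree -mulnn; clear; lia.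
apply: (chromatic_number_leq (h := 20 * m) (D := D) (big := big) (K := K) Gt Gg t0) => //.
- by rewrite muln_gt0.
- exact: undominated_exponent.
- by rewrite hD; clear; lia.
- exact: leq_trans bk cs.
- have h1 : 48 * 560 <= q * K by move: hq K0; clear; nia.
  apply: leq_trans hpow; apply: leq_trans hs; rewrite hD.
  have := leq_mul h1 (leqnn (big * k.+1 * (m * t))); move: (k.+1); clear; lia.
- have h1 : 16 * 560 <= q * (big * k.+1) by move: hq b0; clear; nia.
  apply: leq_trans hpow; apply: leq_trans hs; rewrite hD.
  have := leq_mul h1 (leqnn (K * (m * t))); move: (k.+1); clear; lia.
Qed.

(* From integers to real powers *)
From mathcomp Require Import all_boot all_order all_algebra.
From mathcomp Require Import all_classical all_reals all_analysis.
Import Order.TTheory GRing.Theory Num.Theory.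
Local Open Scope ring_scope.

Lemma leq_exp2_sqrt_ln (R : realType) (t m : nat) : (0 < t)%N ->
  Num.sqrt (ln (t%:R : R)) <= m%:R * Num.sqrt (ln 2) -> (t <= 2 ^ (m ^ 2))%N.
Proof.
move=> t0 h; have ln2 : 0 < ln (2 : R) by rewrite ln_gt0 // ltr1n.
have lnt : 0 <= ln (t%:R : R) by rewrite ln_ge0 // ler1n.
rewrite -(ler_nat R) natrX -ler_ln ?posrE ?exprn_gt0 ?ltr0n // lnXn //.
rewrite -[ln _]sqr_sqrtr // -[X in _ <= X *+ _](sqr_sqrtr (ltW ln2)).
rewrite -[leRHS]mulr_natl natrX -exprMn lerXn2r // nnegrE ?sqrtr_ge0 //.
Qed.

Theorem proposition32 (R : realType) (k : nat) (hk : (1 <= k)%N) :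
  exists C : R, forall (t : nat) (G : sgraph),
    (2 <= t)%N ->
    minor_free (complete_graph t) G ->
    girth_at_least G (4 * k + 1) ->
    (chromatic_number G)%:R
      <= C * (t%:R * Num.sqrt (ln t%:R)) `^ (2%:R / (2 * k + 1)%:R).
Proof.
case: k hk => // k _; have [c c0 hc] := chromatic_number_powers k.
set n := (2 * k.+1 + 1)%N; pose r : R := n%:R^-1.
have n0 : (0 < n)%N by rewrite /n addn1.
have r0 : 0 <= r by rewrite invr_ge0 ler0n.
pose l : R := Num.sqrt (ln 2).
have ln2 : 0 < ln (2 : R) by rewrite ln_gt0 // ltr1n.
have l0 : 0 < l by rewrite sqrtr_gt0.
pose q : R := (c%:R * (2 / l)) `^ r.
(* Bounds s / a^r: q comes from y, and the additive constant [c.+1] in s is absorbed because a >=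
   l. *)
pose B : R := c.+1%:R / (l `^ r) + q.
exists (32 * B ^+ 2) => t G t2 Gt Gg.
have t0 : (0 < t)%N by apply: leq_trans t2.
set x : R := Num.sqrt (ln t%:R); set a : R := t%:R * x.
have lx : l <= x.
  by rewrite ler_wsqrtr // ler_ln ?posrE ?ltr0n // ler_nat.
have x0 : 0 < x by apply: lt_le_trans lx.
have la : l <= a by apply: le_trans lx _; rewrite ler_peMl ?ler1n // ltW.
have a0 : 0 < a by apply: lt_le_trans la.
have ca0 : 0 <= c%:R * (2 / l) :> R by rewrite mulr_ge0 ?ler0n // divr_ge0 // ltW.
(* Rounds sqrt(log2 t) up, so that t <= 2^(m^2); since t >= 2 the ratio x / l is at least 1 and
   rounding at most doubles it. *)
pose m := (Num.truncn (x / l)).+1.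
have hm1 : x <= m%:R * l by rewrite -ler_pdivrMr // ltW // truncnS_gt.
have hm2 : m%:R <= 2 / l * x.
  have h1 : 1 <= x / l by rewrite ler_pdivlMr // mul1r.
  have h2 : (Num.truncn (x / l))%:R <= x / l by rewrite truncn_le (le_trans _ h1).
  rewrite /m -addn1 natrD mulrAC -mulrA mulr_natl mulr2n.
  exact: lerD.
pose z := a `^ r; pose y := q * z.
have z0 : 0 < z by apply: powR_gt0.
have y0 : 0 <= y by rewrite mulr_ge0 ?powR_ge0.
have yn : y ^+ n = c%:R * (2 / l) * a.
  rewrite /y /q /z -powRM //; last exact: ltW.
  rewrite -powR_mulrn ?powR_ge0 // -powRrM /r mulVf ?pnatr_eq0 -?lt0n //.
  by rewrite powRr1 // mulr_ge0 // ltW.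
(* The summand c secures c <= s, and the rest secures s >= y, hence s^n >= c m t. *)
pose s := (c + (Num.truncn y).+1)%N.
have ys : y <= s%:R.
  by rewrite /s natrD; apply: le_trans (ltW (truncnS_gt y)) _; rewrite lerDr ler0n.
have hs : (c * m * t <= s ^ n)%N.
  rewrite -(ler_nat R) natrX; apply: le_trans (_ : y ^+ n <= _); last first.
    by rewrite lerXn2r // nnegrE ler0n.
  rewrite yn !natrM -!mulrA ler_pM2l ?ltr0n // /a.
  by rewrite [leRHS](_ : _ = 2 / l * x * t%:R) ?ler_pM2r ?ltr0n // -!mulrA [t%:R * x]mulrC.
have chi := hc G t m s Gt Gg t0 isT (leq_exp2_sqrt_ln t0 hm1) (leq_addr _ _) hs.
have sB : s%:R <= B * z.
  rewrite /B mulrDl -/y /s addnS -addSn natrD lerD //; last by rewrite truncn_le.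
  rewrite -mulrA ler_peMr ?ler0n // mulrC ler_pdivlMr ?powR_gt0 // mul1r.
  by apply: ge0_ler_powR => //; rewrite nnegrE ltW.
have -> : 2%:R / n%:R = r * 2%:R by rewrite mulrC.
rewrite powRrM powR_mulrn ?powR_ge0 // -/z -mulrA -exprMn.
apply: le_trans (_ : (32 * s ^ 2)%N%:R <= _); first by rewrite ler_nat.
rewrite natrM natrX ler_pM2l ?ltr0n // lerXn2r // nnegrE ?ler0n //.
exact: le_trans sB.
Qed.
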